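(* Every nonzero irreducible representation $\rho:\mathfrak{OA}\to\mathfrak{sl}(V)$ on a finite-dimensional complex vector space $V$ is equivalent to $\rho_{({\bf a},{\bf s})}$ for some $n\ge1$, some ${\bf a}=(a_1,\dots,a_n)\in(\mathbb C^* )^n$ with $a_j\neq\pm1$ and $a_j\neq a_k^{\pm1}$ for $j\neq k$, and some ${\bf s}=(s_1,\dots,s_n)$ of positive half-integers. Consequently the irreducible Hermitian representations $\rho:\mathfrak{OA}\to\mathfrak{sl}(V)$ ($V\ne0$ nontrivial action) are, up to equivalence, exactly the $\rho_{({\bf a},{\bf s})}$ with $\hat a_1,\dots,\hat a_n$ pairwise distinct elements of $(-1,1)$ and ${\bf s}$ positive half-integers, and two such, $\rho_{({\bf a},{\bf s})}$ and $\rho_{({\bf a}',{\bf s}')}$, are equivalent if and only if $n=n'$ and $(\hat a'_j,s'_j)=(\hat a_{\sigma(j)},s_{\sigma(j)})$ for some permutation $\sigma$.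
   Context: Work over $\mathbb C$; representations are finite-dimensional. $\mathfrak{sl}_2$ has basis $e,f,h$ with $[e,f]=h$, $[h,e]=2e$, $[h,f]=-2f$. The Onsager algebra is the Lie subalgebra $\mathfrak{OA}=\{p(t)e+p(t^{-1})f+q(t)h:\ p,q\in\mathbb C[t,t^{-1}],\ q(t^{-1})=-q(t)\}$ of the loop algebra $\mathbb C[t,t^{-1}]\otimes\mathfrak{sl}_2$, containing $A_m=2t^me+2t^{-m}f$. For $a\in\mathbb C^*$, $ev_a:\mathfrak{OA}\to\mathfrak{sl}_2$, $p(t)x\mapsto p(a)x$, and $\hat a=(a+a^{-1})/2$. For a positive half-integer $s$, $V(s)$ is the irreducible $(2s+1)$-dimensional representation of $\mathfrak{sl}_2$. For ${\bf a}\in(\mathbb C^* )^n$ and ${\bf s}=(s_1,\dots,s_n)$, $\rho_{({\bf a},{\bf s})}$ is the representation of $\mathfrak{OA}$ on $V(s_1)\otimes\cdots\otimes V(s_n)$ with $\rho_{({\bf a},{\bf s})}(X)=\sum_j1\otimes\cdots\otimes ev_{a_j}(X)\otimes\cdots\otimes1$ ($j$-th slot); its equivalence class depends only on $(\hat a_j)$ and ${\bf s}$. A representation $\rho$ on $V$ is Hermitian if for some Hermitian inner product on $V$ the operators $\rho(A_0),\rho(A_1)$ are Hermitian. *)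

(* Defs.v *)
(* The complex numbers are modelled as R[i] for R : realType
   (mathcomp-real-closed `complex`); all definitions below are generic over a
   numClosedFieldType C and instantiated at C := R[i] in the theorem. *)
From HB Require Import structures.
From mathcomp Require Import all_boot all_order all_algebra.
From mathcomp Require Import reals complex.
Set Implicit Arguments. Unset Strict Implicit. Unset Printing Implicit Defensive.
Import Order.TTheory GRing.Theory Num.Theory.
Local Open Scope ring_scope.

Section Onsager.
Variable C : numClosedFieldType.

(* ---------- sl_2 ---------- *)
(* standard basis of sl_2 = traceless 2x2 matrices *)
Definition sl2_e : 'M[C]_2 := \matrix_(i, j) ((i == 0 :> nat) && (j == 1 :> nat))%:R.
Definition sl2_f : 'M[C]_2 := \matrix_(i, j) ((i == 1 :> nat) && (j == 0 :> nat))%:R.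
Definition sl2_h : 'M[C]_2 :=
  \matrix_(i, j) (((i == 0 :> nat) && (j == 0 :> nat))%:R
                  - ((i == 1 :> nat) && (j == 1 :> nat))%:R).

(* ---------- loop algebra and the Onsager algebra ---------- *)
(* An element of C[t,t^-1] (x) sl_2 is modelled by its evaluation function
   a |-> ev_a(X) on nonzero a (a Laurent polynomial is determined by its values on
   the infinite set of nonzero a), with the normalisation X 0 = 0.  The Lie bracket of
   the loop algebra is then the pointwise commutator. *)
Definition is_laurent (g : C -> C) : Prop :=
  exists (N : nat) (P : {poly C}), forall a, a != 0 -> g a = P.[a] / a ^+ N.

(* p(t) e + p(t^{-1}) f + q(t) h *)
Definition OAelt (p q : C -> C) : C -> 'M[C]_2 :=
  fun a => if a == 0 then 0
           else p a *: sl2_e + p a^-1 *: sl2_f + q a *: sl2_h.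

(* membership in the Onsager algebra OA *)
Definition in_OA (X : C -> 'M[C]_2) : Prop :=
  exists p q : C -> C, [/\ is_laurent p, is_laurent q,
     (forall a, a != 0 -> q a^-1 = - q a) & X = OAelt p q].

(* A_m = 2 t^m e + 2 t^{-m} f *)
Definition OA_A (m : int) : C -> 'M[C]_2 := OAelt (fun a => 2 * a ^ m) (fun _ => 0).

(* evaluation homomorphism ev_a : OA -> sl_2 *)
Definition ev (a : C) (X : C -> 'M[C]_2) : 'M[C]_2 := X a.

(* ---------- representations on V = C^m (column vectors) ---------- *)
Definition OA_rep := fun m : nat => (C -> 'M[C]_2) -> 'M[C]_m.

(* rho : OA -> sl(V) is a Lie algebra homomorphism (linear, bracket
   preserving, with values in traceless operators). *)
Definition is_sl_rep m (rho : OA_rep m) : Prop :=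
  [/\ (forall c X Y, in_OA X -> in_OA Y ->
          rho (fun a => c *: X a + Y a) = c *: rho X + rho Y),
      (forall X Y, in_OA X -> in_OA Y ->
          rho (fun a => X a *m Y a - Y a *m X a) = rho X *m rho Y - rho Y *m rho X)
    & (forall X, in_OA X -> \tr (rho X) = 0)].

Definition rep_nonzero m (rho : OA_rep m) : Prop :=
  exists X, in_OA X /\ rho X != 0.

(* irreducible: V <> 0 and the only invariant subspaces (column spaces of W)
   are 0 and V *)
Definition rep_irreducible m (rho : OA_rep m) : Prop :=
  (0 < m)%N /\
  forall W : 'M[C]_m,
    (forall X, in_OA X -> exists Z : 'M[C]_m, rho X *m W = W *m Z) ->
    W = 0 \/ \rank W = m.

(* equivalence: an invertible intertwiner P : V' -> V *)
Definition rep_equiv m m' (rho : OA_rep m) (rho' : OA_rep m') : Prop :=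
  exists (P : 'M[C]_(m, m')) (Q : 'M[C]_(m', m)),
    [/\ P *m Q = 1%:M, Q *m P = 1%:M &
        forall X, in_OA X -> rho X *m P = P *m rho' X].

(* Hermitian: rho(A_0), rho(A_1) self-adjoint for some Hermitian inner product *)
Definition rep_hermitian m (rho : OA_rep m) : Prop :=
  exists ip : 'cV[C]_m -> 'cV[C]_m -> C,
    [/\ (forall c u v w, ip (c *: u + v) w = c * ip u w + ip v w),
        (forall u w, ip w u = (ip u w)^*),
        (forall u, u != 0 -> 0 < ip u u),
        (forall u w, ip (rho (OA_A 0) *m u) w = ip u (rho (OA_A 0) *m w))
      & (forall u w, ip (rho (OA_A 1) *m u) w = ip u (rho (OA_A 1) *m w))].

(* ---------- the irreducible sl_2 modules ---------- *)
(* V(s) with 2s = d, dimension d+1, basis v_0..v_d (column convention):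
   f v_k = v_{k+1}, e v_k = k(d+1-k) v_{k-1}, h v_k = (d-2k) v_k. *)
Definition spin_e (d : nat) : 'M[C]_d.+1 :=
  \matrix_(i, j) (if (j == i.+1 :> nat) then (j * (d.+1 - j))%:R else 0).
Definition spin_f (d : nat) : 'M[C]_d.+1 :=
  \matrix_(i, j) (if (i == j.+1 :> nat) then 1 else 0).
Definition spin_h (d : nat) : 'M[C]_d.+1 :=
  \matrix_(i, j) (if i == j then d%:R - 2 * (i : nat)%:R else 0).

(* action on V(s) of M = y e + z f + x h in sl_2 *)
Definition spin_mat (d : nat) (M : 'M[C]_2) : 'M[C]_d.+1 :=
  M ord0 ord_max *: spin_e d + M ord_max ord0 *: spin_f d + M ord0 ord0 *: spin_h d.

(* ---------- rho_(a,s) on V(s_1) (x) ... (x) V(s_n) ---------- *)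
(* ss j = 2 s_j; the tensor product basis is indexed by TT ss *)
Definition TT n (ss : 'I_n -> nat) := {dffun forall j : 'I_n, 'I_(ss j).+1}.

Definition tidx n (ss : 'I_n -> nat) (i : 'I_#|TT ss|) : TT ss := enum_val i.

Definition rhoAS n (a : 'I_n -> C) (ss : 'I_n -> nat) : OA_rep #|TT ss| :=
  fun X => \matrix_(i, k)
    \sum_(j < n)
      (if [forall l, (l != j) ==> (tidx i l == tidx k l)]
       then spin_mat (ss j) (ev (a j) X) (tidx i j) (tidx k j)
       else 0).

(* \hat a = (a + a^{-1})/2 *)
Definition ahat (a : C) : C := (a + a^-1) / 2.

End Onsager.

(* Main.v *)
Require Import Defs.
From HB Require Import structures.
From mathcomp Require Import all_boot all_order all_algebra.
From mathcomp Require Import reals complex.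
From mathcomp Require Import boolp ring.
Import Order.TTheory GRing.Theory Num.Theory.
Local Open Scope ring_scope.
Set Implicit Arguments. Unset Strict Implicit. Unset Printing Implicit Defensive.

(* Diagonalising the fixed vector e + f gives OA a triangular decomposition:
   with x = t + t^-1 and d = t - t^-1 it is spanned by H_p = p(x) X, E_p = d p(x) E'
   and F_p = d p(x) F', p a polynomial, where (E', F', X = e + f) is an sl_2-triple
   and [E_p, F_q] = H_{(x^2-4)pq}. Irreducible finite-dimensional representations
   are therefore determined by the eigenvalue functional lam of the H_p on a highest
   weight vector. Let J be the ideal of the p with lam((x^2-4)pq) = 0 for all q. It
   is nonzero by finite dimension, E_p and F_p vanish for p in J, and strings
   E F^k v show that (x^2-4)p^2 in J forces p in J; so J is generated by a
   polynomial with simple roots, none of them 2 or -2. Tracelessness makes lam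
   vanish on J, so lam is a combination of evaluations at these roots, with
   coefficients in nat by sl_2-theory: it is the highest weight of some
   rho_(a,s). Those are irreducible because Lagrange interpolation isolates each
   tensor slot. In a Hermitian representation E_1 is adjoint to -F_1 and H_x is
   self-adjoint, so the points x_j are real, and |F_{l_j} v|^2 > 0 gives x_j^2 < 4. *)

(** * Subspaces and common eigenvectors *)

(** OA is the fixed algebra of the involution e <-> f, h -> -h, t -> t^-1. It fixes X and negates E'
    and F', which is why X carries even coefficients p(x) and E', F' odd ones d p(x). The resulting
    factor x^2-4 in [E_p, F_q] is the obstacle: at t = 1 and t = -1 the E_p and F_p evaluate to 0
    and only X survives, leaving the one-dimensional characters sending H_p to p(2) or p(-2).
    Tracelessness excludes twists by these. In this basis A_0 = 2 H_1 and A_1 = H_x + E_1 - F_1, so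
    the Hermitian condition is a statement about H_1, H_x, E_1 and F_1. *)

Lemma mulmx_ext (R : pzSemiRingType) m n (A B : 'M[R]_(m, n)) :
  (forall w : 'cV_n, A *m w = B *m w) -> A = B.
Proof.
move=> AB; apply/matrixP => i j.
by have /colP/(_ i) := AB (delta_mx j 0); rewrite -!colE !mxE.
Qed.

Section Subspaces.
Variables (C : numClosedFieldType) (m : nat).
Implicit Types (P Q : 'cV[C]_m -> Prop) (A : 'M[C]_m) (u v w : 'cV[C]_m).

Definition subspace P := P 0 /\ forall c u v, P u -> P v -> P (c *: u + v).

Lemma subspaceD P u v : subspace P -> P u -> P v -> P (u + v).
Proof. by move=> [_ PD] Pu Pv; rewrite -[u]scale1r; apply: PD. Qed.

Lemma subspaceZ P c u : subspace P -> P u -> P (c *: u).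
Proof. by move=> [P0 PD] Pu; rewrite -[_ *: _]addr0; apply: PD. Qed.

Lemma subspaceB P u v : subspace P -> P u -> P v -> P (u - v).
Proof. by move=> sP Pu Pv; rewrite addrC -scaleN1r; apply: sP.2. Qed.

Lemma subspace_sum P I (r : seq I) (F : I -> 'cV[C]_m) :
  subspace P -> (forall i, P (F i)) -> P (\sum_(i <- r) F i).
Proof.
by move=> sP PF; elim/big_ind: _ => // [|u v]; [exact: sP.1 | exact: subspaceD].
Qed.

Lemma subspace_mulmx n P (A : 'M[C]_(m, n)) : subspace P ->
  (forall j, P (col j A)) ->
  forall v : 'cV[C]_n, P (A *m v).
Proof.
move=> sP PA v; have -> : A *m v = \sum_j v j 0 *: col j A.
  apply/colP => i; rewrite mxE summxE; apply: eq_bigr => j _.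
  by rewrite !mxE mulrC.
by apply: subspace_sum => // j; apply: subspaceZ.
Qed.

(** A row space inside [P] of maximal rank is all of [P], since a further vector of [P] would raise
    the rank. This trades a predicate for a matrix when a dimension is needed. *)
Lemma subspace_rowmx P : subspace P ->
  exists W : 'M[C]_m, forall v, P v <-> (v^T <= W)%MS.
Proof.
move=> sP.
pose inP k := `[< exists W : 'M[C]_m,
  (forall u : 'rV_m, (u <= W)%MS -> P u^T) /\ \rank W = k >].
have ex : exists k, inP k.
  exists 0%N; apply/asboolP; exists 0; split; last by rewrite mxrank0.
  by move=> u /submx0null ->; rewrite trmx0; exact: sP.1.
have bnd k : inP k -> (k <= m)%N.
  by move=> /asboolP [W [_ <-]]; apply: rank_leq_row.
have [k /asboolP [W [WP Wk]] kmax] := ex_maxnP ex bnd.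
exists W => v; split; last by move=> /WP; rewrite trmxK.
move=> Pv; apply: contraT => vW.
have : inP (\rank (W + v^T)%MS).
  apply/asboolP; exists (W + v^T)%MS; split => // u /sub_addsmxP [[a b] /= ->].
  rewrite linearD /=; apply: subspaceD => //; first by apply: WP; apply: submxMl.
  have -> : (b *m v^T)^T = b 0 0 *: v.
    by apply/colP => i; rewrite !mxE big_ord1 !mxE.
  exact: subspaceZ.
move=> /kmax; rewrite -Wk leqNgt rank_ltmx //.
by rewrite /ltmx addsmxSl addsmx_sub submx_refl vW.
Qed.

(** By Cayley-Hamilton the factors [A - r%:M] of the characteristic polynomial, applied to [v] one
    after another, end in 0. All intermediate vectors stay in [P], and the last nonzero one is an
    eigenvector. *)
Lemma eigenvector_in A P : subspace P -> (forall v, P v -> P (A *m v)) ->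
  (exists v, P v /\ v != 0) -> exists v c, [/\ v != 0, P v & A *m v = c *: v].
Proof.
move=> sP PA [v [Pv v0]].
have key (s : seq C) u : P u -> u != 0 ->
    foldr (fun r w => (A - r%:M) *m w) u s = 0 ->
    exists v c, [/\ v != 0, P v & A *m v = c *: v].
  elim/last_ind: s u => [|s r IH] u Pu u0 /=; first by move=> u00; rewrite u00 eqxx in u0.
  rewrite foldr_rcons => su.
  have [Aru|Aru] := eqVneq ((A - r%:M) *m u) 0; last apply: IH su => //.
    exists u, r; split => //; apply/eqP; rewrite -subr_eq0.
    by rewrite -mul_scalar_mx -mulmxBl Aru.
  by rewrite mulmxBl mul_scalar_mx; apply: subspaceB; [|exact: PA|exact: subspaceZ].
have [s chA] := closed_field_poly_normal (char_poly A).
apply: (key s v) => //.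
have -> : foldr (fun r w => (A - r%:M) *m w) v s =
   \big[mulmx/1%:M]_(r <- s) (A - r%:M) *m v.
  elim: s {chA} => [|r s IH] /=; first by rewrite big_nil mul1mx.
  by rewrite big_cons IH mulmxA.
clear -chA; move: A chA v; case: m => [|n] A chA v; first by rewrite [_ *m _]flatmx0.
move: (Cayley_Hamilton A); rewrite {1}chA (monicP (char_poly_monic A)) scale1r.
rewrite rmorph_prod /=.
under eq_bigr do rewrite rmorphB /= horner_mx_X horner_mx_C.
by move=> ->; rewrite mul0mx.
Qed.

(** [S] may be infinite, so the induction is on the dimension of [P]. If [v] is not an eigenvector
    of some [A] in [S], an eigenspace of [A] in [P] is nonzero, omits [v], and is stable under [S]
    by commutation. *)
Lemma common_eigenvector_in (S : 'M[C]_m -> Prop) P :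
  (forall A B, S A -> S B -> A *m B = B *m A) ->
  subspace P -> (forall A v, S A -> P v -> P (A *m v)) ->
  (exists v, P v /\ v != 0) ->
  exists v, [/\ v != 0, P v & forall A, S A -> exists c, A *m v = c *: v].
Proof.
move=> Sc; have key k : forall P (W : 'M[C]_m), (\rank W <= k)%N ->
    (forall v, P v <-> (v^T <= W)%MS) ->
    subspace P -> (forall A v, S A -> P v -> P (A *m v)) ->
    (exists v, P v /\ v != 0) ->
    exists v, [/\ v != 0, P v & forall A, S A -> exists c, A *m v = c *: v].
  elim: k => [|k IH] {}P W.
    rewrite leqn0 mxrank_eq0 => /eqP -> PW _ _ [v [/PW /submx0null /eqP]].
    by rewrite trmx_eq0 => ->.
  move=> Wk PW sP PS [v [Pv v0]].
  have [allS|] := pselect (forall A, S A -> exists c, A *m v = c *: v).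
    by exists v.
  move=> /existsNP [A /not_implyP [SA Av]].
  have [|u [r [u0 Pu ur]]] := @eigenvector_in A P sP (fun u => PS A u SA).
    by exists v.
  pose Q w := P w /\ A *m w = r *: w.
  have sQ : subspace Q.
    split; first by split; [exact: sP.1 | rewrite mulmx0 scaler0].
    move=> c w1 w2 [P1 e1] [P2 e2]; split; first exact: sP.2.
    by rewrite mulmxDr -scalemxAr e1 e2 scalerDr !scalerA mulrC.
  have [W' QW'] := subspace_rowmx sQ.
  have [|||w [w0 [Pw _] wS]] := IH Q W' _ QW' sQ.
  - rewrite -ltnS; apply: leq_trans Wk; apply: rank_ltmx; rewrite /ltmx.
    apply/andP; split.
      apply/row_subP => i; rewrite -[row i W']trmxK -PW.
      by have [] : Q (row i W')^T by rewrite QW' trmxK row_sub.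
    apply/negP => WW'; apply: Av; exists r.
    by have [] : Q v by rewrite QW'; apply: submx_trans WW'; rewrite -PW.
  - move=> B w SB [Pw Aw]; split; first exact: PS.
    by rewrite mulmxA (Sc A B) // -mulmxA Aw scalemxAr.
  - by exists u.
  by exists w.
move=> sP; have [W PW] := subspace_rowmx sP.
exact: (key (\rank W) P W).
Qed.

(** The [a + b *+ k] are pairwise distinct, and only [m] of them can be eigenvalues. Both the
    existence of highest weight vectors and the nilpotency of lowering operators rest on this. *)
Lemma eigen_sequence_vanishes A (a b : C) (u : nat -> 'cV[C]_m) : b != 0 ->
  (forall k, A *m u k = (a + b *+ k) *: u k) -> exists k, u k = 0.
Proof.
move=> b0 Au; apply: contrapT => /forallNP u0.
have inj : injective (fun k : nat => a + b *+ k).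
  move=> i j /addrI; rewrite -(mulr_natr b i) -(mulr_natr b j) => /(mulfI b0) /eqP.
  by rewrite eqr_nat => /eqP.
pose rs := [seq a + b *+ k | k <- iota 0 m.+1].
have := @max_poly_roots _ (char_poly A^T) rs.
rewrite size_char_poly size_map size_iota ltnn => /(_ _ _ _)/notF; apply.
- by rewrite -size_poly_eq0 size_char_poly.
- apply/allP => _ /mapP [k _ ->]; rewrite -eigenvalue_root_char.
  apply/eigenvalueP; exists (u k)^T; last by rewrite trmx_eq0; apply/eqP/u0.
  by rewrite -trmx_mul Au linearZ.
- by rewrite map_inj_uniq ?iota_uniq.
Qed.

End Subspaces.

(** * Highest weight theory *)

Definition disc {C : numClosedFieldType} : {poly C} := 'X^2 - 4%:P.

(** Keeping only the operators of E_p, F_p, H_p and their relations allows duals and direct sums to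
    be formed without going back to functions on loops. *)
Record onsager_module (C : numClosedFieldType) (m : nat) := OnsagerModule {
  opE : {poly C} -> 'M[C]_m;
  opF : {poly C} -> 'M[C]_m;
  opH : {poly C} -> 'M[C]_m;
  opE_linear : forall c p q, opE (c *: p + q) = c *: opE p + opE q;
  opF_linear : forall c p q, opF (c *: p + q) = c *: opF p + opF q;
  opH_linear : forall c p q, opH (c *: p + q) = c *: opH p + opH q;
  opEE : forall p q, opE p *m opE q = opE q *m opE p;
  opFF : forall p q, opF p *m opF q = opF q *m opF p;
  opHH : forall p q, opH p *m opH q = opH q *m opH p;
  opHE : forall r p, opH r *m opE p = opE p *m opH r + 2 *: opE (r * p);
  opHF : forall r p, opH r *m opF p = opF p *m opH r - 2 *: opF (r * p);
  opEF : forall p q, opE p *m opF q = opF q *m opE p + opH (disc * p * q) }.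

Section OnsagerModules.
Variable C : numClosedFieldType.
Implicit Types (m n : nat) (p q r : {poly C}).

Definition op_stable m (M : onsager_module C m) (P : 'cV[C]_m -> Prop) :=
  forall p v, P v -> [/\ P (opE M p *m v), P (opF M p *m v) & P (opH M p *m v)].

Definition op_irreducible m (M : onsager_module C m) :=
  forall P, subspace P -> op_stable M P -> (exists v, P v /\ v != 0) ->
  forall v, P v.

Definition highest_weight m (M : onsager_module C m) (v : 'cV[C]_m) (lam : {poly C} -> C) :=
  [/\ v != 0, forall p, opE M p *m v = 0 & forall p, opH M p *m v = lam p *: v].

Lemma highest_weight_linear m (M : onsager_module C m) v lam c p q :
  highest_weight M v lam -> lam (c *: p + q) = c * lam p + lam q.
Proof.
move=> [v0 _ Hv]; apply/eqP; rewrite -subr_eq0.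
have : (lam (c *: p + q) - (c * lam p + lam q)) *: v == 0.
  by rewrite scalerBl -Hv opH_linear mulmxDl -scalemxAl !Hv scalerDl scalerA subrr.
by rewrite scaler_eq0 (negPf v0) orbF.
Qed.

Lemma lowering_weight m (M : onsager_module C m) v lam r p c :
  highest_weight M v lam -> opF M (r * p) = c *: opF M p ->
  opH M r *m (opF M p *m v) = (lam r - 2 * c) *: (opF M p *m v).
Proof.
move=> [_ _ Hv] rp; rewrite mulmxA opHF rp mulmxBl -mulmxA Hv.
by rewrite -scalemxAr scalerA -scalemxAl -scalerBl.
Qed.

Lemma raising_lowering m (M : onsager_module C m) v lam p q :
  highest_weight M v lam -> opE M p *m (opF M q *m v) = lam (disc * p * q) *: v.
Proof. by move=> [_ Ev Hv]; rewrite mulmxA opEF mulmxDl -mulmxA Ev mulmx0 add0r Hv. Qed.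

(** Each [opE] raises the eigenvalue of [opH M 1] by 2, so an eigenspace at the top of such a chain
    is killed by every [opE]. The commuting [opH] preserve it and have a common eigenvector
    there. *)
Lemma highest_weight_exists m (M : onsager_module C m) : (0 < m)%N ->
  exists v lam, highest_weight M v lam.
Proof.
case: m M => // m M _.
have [|||u [c [u0 _ uc]]] := @eigenvector_in C m.+1 (opH M 1) (fun=> True); try by [].
  exists (const_mx 1); split => //; apply/eqP => /colP/(_ 0)/eqP.
  by rewrite !mxE oner_eq0.
pose eig a (w : 'cV[C]_m.+1) := opH M 1 *m w = a *: w.
have Eeig p a w : eig a w -> eig (a + 2) (opE M p *m w).
  rewrite /eig => wa; rewrite mulmxA opHE mul1r mulmxDl -mulmxA wa.
  by rewrite -scalemxAr -scalemxAl scalerDl.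
have [a [w [w0 wa wE]]] : exists a w, [/\ w != 0, eig a w &
    forall x, eig (a + 2) x -> x = 0].
  apply: contrapT => top.
  have nxt (k : nat) : exists w, w != 0 /\ eig (c + 2 *+ k) w.
    elim: k => [|k [w [w0 wk]]]; first by exists u; rewrite mulr0n addr0.
    apply: contrapT => nw; apply: top; exists (c + 2 *+ k), w; split => // x xk.
    apply: contrapT => /eqP x0; apply: nw; exists x; split => //.
    by rewrite mulrSr addrA.
  have [f fP] := choice nxt.
  have n2 : 2 != 0 :> C by rewrite pnatr_eq0.
  have [k fk] := @eigen_sequence_vanishes _ _ (opH M 1) c 2 f n2 (fun k => (fP k).2).
  by have := (fP k).1; rewrite fk eqxx.
have [||||v [v0 va vH]] := @common_eigenvector_in _ _ (fun A => exists p, A = opH M p) (eig a).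
- by move=> _ _ [p ->] [q ->]; apply: opHH.
- split; first by rewrite /eig mulmx0 scaler0.
  by move=> k x y xa ya; rewrite /eig mulmxDr -scalemxAr xa ya scalerDr !scalerA mulrC.
- move=> _ x [p ->] xa.
  by rewrite /eig mulmxA opHH -mulmxA xa -scalemxAr.
- by exists w.
exists v; have [f fP] := choice (fun p => vH (opH M p) (ex_intro _ p erefl)).
by exists f; split => // p; apply: wE; apply: Eeig.
Qed.

(** Transposition reverses products, and exchanging raising with lowering repairs the relations.
    Unlike in the contragredient module, [opH] keeps its sign, so weights compare directly with
    those of [M]. *)
Definition dual_module m (M : onsager_module C m) : onsager_module C m.
Proof.
refine (@OnsagerModule C m (fun p => (opF M p)^T) (fun p => (opE M p)^T)
  (fun p => (opH M p)^T) _ _ _ _ _ _ _ _ _).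
- by move=> c p q; rewrite opF_linear linearP.
- by move=> c p q; rewrite opE_linear linearP.
- by move=> c p q; rewrite opH_linear linearP.
- by move=> p q; rewrite -!trmx_mul opFF.
- by move=> p q; rewrite -!trmx_mul opEE.
- by move=> p q; rewrite -!trmx_mul opHH.
- by move=> r p; rewrite -!trmx_mul opHF linearB linearZ /= subrK.
- by move=> r p; rewrite -!trmx_mul opHE linearD linearZ /= addrK.
- by move=> p q; rewrite -!trmx_mul opEF linearD /= mulrAC.
Defined.

Definition direct_sum m n (M : onsager_module C m) (M' : onsager_module C n) :
  onsager_module C (m + n).
Proof.
refine (@OnsagerModule C (m + n)
  (fun p => block_mx (opE M p) 0 0 (opE M' p))
  (fun p => block_mx (opF M p) 0 0 (opF M' p))
  (fun p => block_mx (opH M p) 0 0 (opH M' p)) _ _ _ _ _ _ _ _ _).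
- by move=> c p q; rewrite !opE_linear scale_block_mx add_block_mx !scaler0 !addr0.
- by move=> c p q; rewrite !opF_linear scale_block_mx add_block_mx !scaler0 !addr0.
- by move=> c p q; rewrite !opH_linear scale_block_mx add_block_mx !scaler0 !addr0.
- by move=> p q; rewrite !mulmx_block !mulmx0 !mul0mx !addr0 !add0r opEE (opEE M').
- by move=> p q; rewrite !mulmx_block !mulmx0 !mul0mx !addr0 !add0r opFF (opFF M').
- by move=> p q; rewrite !mulmx_block !mulmx0 !mul0mx !addr0 !add0r opHH (opHH M').
- move=> r p; rewrite !mulmx_block scale_block_mx add_block_mx !mulmx0 !mul0mx.
  by rewrite !scaler0 !addr0 !add0r opHE (opHE M').
- move=> r p; rewrite !mulmx_block scale_block_mx opp_block_mx add_block_mx !mulmx0 !mul0mx.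
  by rewrite !scaler0 !oppr0 !addr0 !add0r opHF (opHF M').
- move=> p q; rewrite !mulmx_block add_block_mx !mulmx0 !mul0mx.
  by rewrite !addr0 !add0r opEF (opEF M').
Defined.

(** The span of all words in the [opF] applied to [B]; the inductive form avoids any ordered basis
    of such words. *)
Inductive fspan m (M : onsager_module C m) (B : 'cV[C]_m -> Prop) : 'cV[C]_m -> Prop :=
| fspan0 : fspan M B 0
| fspan_base b : B b -> fspan M B b
| fspan_linear c u w : fspan M B u -> fspan M B w -> fspan M B (c *: u + w)
| fspanF p w : fspan M B w -> fspan M B (opF M p *m w).

Lemma fspan_subspace m (M : onsager_module C m) B : subspace (fspan M B).
Proof. by split; [exact: fspan0 | exact: fspan_linear]. Qed.

(** Moving [opE] past [opF] leaves an [opH], whereas moving [opH] past [opF] leaves only another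
    [opF]; hence stability under [opH] is settled first. *)
Lemma fspan_stable m (M : onsager_module C m) (B : 'cV[C]_m -> Prop) :
  (forall p b, B b -> opE M p *m b = 0) ->
  (forall p b, B b -> fspan M B (opH M p *m b)) -> op_stable M (fspan M B).
Proof.
move=> BE BH; have sB := fspan_subspace M B.
have stH p w : fspan M B w -> fspan M B (opH M p *m w).
  move=> Bw; elim: Bw p => {w} [|b Bb|c u w _ IHu _ IHw|q w Bw IHw] p.
  - by rewrite mulmx0; apply: fspan0.
  - exact: BH.
  - by rewrite mulmxDr -scalemxAr; apply: fspan_linear.
  - rewrite mulmxA opHF mulmxBl -mulmxA -scalemxAl; apply: subspaceB => //.
      exact: fspanF.
    by apply: subspaceZ => //; apply: fspanF.
move=> p w Bw; split; [|exact: fspanF|exact: stH].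
elim: Bw p => {w} [|b Bb|c u w _ IHu _ IHw|q w Bw IHw] p.
- by rewrite mulmx0; apply: fspan0.
- by rewrite BE //; apply: fspan0.
- by rewrite mulmxDr -scalemxAr; apply: fspan_linear.
- rewrite mulmxA opEF mulmxDl -mulmxA; apply: subspaceD => //; last exact: stH.
  exact: fspanF.
Qed.

(** Modulo the images of the [opF], every vector of [fspan M B] is a combination of vectors of
    [B]. *)
Lemma fspan_functional m (M : onsager_module C m) B (phi : 'rV[C]_m) :
  (forall p, phi *m opF M p = 0) -> (forall b, B b -> phi *m b = 0) ->
  forall w, fspan M B w -> phi *m w = 0.
Proof.
move=> phiF phiB w; elim=> {w} [|b /phiB //|c u w _ IHu _ IHw|p w _ _].
- by rewrite mulmx0.
- by rewrite mulmxDr -scalemxAr IHu IHw scaler0 addr0.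
- by rewrite mulmxA phiF mul0mx.
Qed.

Lemma fspan_irreducible m (M : onsager_module C m) (B : 'cV[C]_m -> Prop) b :
  op_irreducible M ->
  (forall p b, B b -> opE M p *m b = 0) ->
  (forall p b, B b -> fspan M B (opH M p *m b)) ->
  B b -> b != 0 -> forall w, fspan M B w.
Proof.
move=> irrM BE BH Bb b0; apply: irrM; first exact: fspan_subspace.
  exact: fspan_stable.
by exists b; split => //; apply: fspan_base.
Qed.

Lemma highest_weight_fspan m (M : onsager_module C m) v lam :
  op_irreducible M -> highest_weight M v lam -> forall w, fspan M (eq v) w.
Proof.
move=> irrM [v0 Ev Hv]; apply: (fspan_irreducible (b := v)) => // p _ <-.
  exact: Ev.
by rewrite Hv; apply: subspaceZ; [exact: fspan_subspace | exact: fspan_base].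
Qed.

(* The highest weight vectors of the dual module are the functionals killing
   the image of every [opF]; they play the role of the coordinate along [v]. *)
Lemma coordinate_functional m (M : onsager_module C m) : (0 < m)%N ->
  exists phi : 'rV[C]_m, exists eta : {poly C} -> C,
  [/\ phi != 0, forall p, phi *m opF M p = 0 & forall p, phi *m opH M p = eta p *: phi].
Proof.
move=> m0; have [u [eta [u0 uE uH]]] := highest_weight_exists (dual_module M) m0.
exists u^T, eta; split => [|p|p]; first by rewrite trmx_eq0.
  by rewrite -[opF M p]trmxK -trmx_mul uE trmx0.
by rewrite -[opH M p]trmxK -trmx_mul uH linearZ.
Qed.

Lemma coordinate_along m (M : onsager_module C m) v lam :
  op_irreducible M -> highest_weight M v lam -> (0 < m)%N ->
  exists phi : 'rV[C]_m, [/\ phi *m v = 1%:M, forall p, phi *m opF M p = 0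
     & forall p, phi *m opH M p = lam p *: phi].
Proof.
move=> irrM hw m0; have [phi [eta [phi0 phiF phiH]]] := coordinate_functional M m0.
have [_ _ Hv] := hw; have phiv : phi *m v != 0.
  apply: contra phi0 => /eqP phiv; apply/eqP/mulmx_ext => w; rewrite mul0mx.
  apply: fspan_functional phiF _ _ (highest_weight_fspan irrM hw w).
  by move=> _ <-.
have a0 : (phi *m v) 0 0 != 0.
  by apply: contra phiv => /eqP a0; apply/eqP; rewrite [LHS]mx11_scalar a0 raddf0.
exists (((phi *m v) 0 0)^-1 *: phi); split => [|p|p].
- by rewrite -scalemxAl {2}[phi *m v]mx11_scalar scale_scalar_mx mulVf.
- by rewrite -scalemxAl phiF scaler0.
- rewrite -scalemxAl phiH !scalerA [lam p * _]mulrC; congr (_ * _ *: _).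
  (* The weight of [phi] is found by computing [phi *m opH M p *m v] from both sides. *)
  apply: (mulIf a0); transitivity ((phi *m opH M p *m v) 0 0).
    by rewrite phiH -scalemxAl [RHS]mxE.
  by rewrite -mulmxA Hv -scalemxAr [LHS]mxE.
Qed.

(** With [phi] the coordinate along [v], evaluate [phi *m opH M p *m v'] from both sides. The factor
    [phi *m v'] is nonzero, because [v'] generates the module and [phi] would otherwise vanish. *)
Lemma highest_weight_unique m (M : onsager_module C m) v lam v' lam' :
  (0 < m)%N -> op_irreducible M -> highest_weight M v lam ->
  highest_weight M v' lam' -> forall p, lam' p = lam p.
Proof.
move=> m0 irrM hw hw' p.
have [phi [phiv phiF phiH]] := coordinate_along irrM hw m0.
have a0 : (phi *m v') 0 0 != 0.
  apply/eqP => a0; have : phi *m v = 0.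
    apply: fspan_functional phiF _ _ (highest_weight_fspan irrM hw' v).
    by move=> _ <-; rewrite [LHS]mx11_scalar a0 raddf0.
  by rewrite phiv => /matrixP/(_ 0 0)/eqP; rewrite !mxE oner_eq0.
have [_ _ Hv'] := hw'.
apply: (mulIf a0); transitivity ((phi *m opH M p *m v') 0 0).
  by rewrite -mulmxA Hv' -scalemxAr [RHS]mxE.
by rewrite phiH -scalemxAl [LHS]mxE.
Qed.

Definition intertwines m n (M : onsager_module C m) (M' : onsager_module C n) (P : 'M[C]_(m, n)) :=
  forall p, [/\ opE M p *m P = P *m opE M' p, opF M p *m P = P *m opF M' p
              & opH M p *m P = P *m opH M' p].

(* In the direct sum, the submodule generated by [(v, v')] is the graph of an
   isomorphism: it meets neither summand, because the coordinates along [v] and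
   [v'] agree on it. *)
Lemma highest_weight_iso m n (M : onsager_module C m) (M' : onsager_module C n) v v' lam :
  (0 < m)%N -> (0 < n)%N -> op_irreducible M -> op_irreducible M' ->
  highest_weight M v lam -> highest_weight M' v' lam ->
  exists (P : 'M[C]_(m, n)) (Q : 'M[C]_(n, m)),
    [/\ P *m Q = 1%:M, Q *m P = 1%:M & intertwines M M' P].
Proof.
move=> m0 n0 irrM irrM' hw hw'.
pose D := direct_sum M M'; pose T w w' := fspan D (eq (col_mx v v')) (col_mx w w').
have [v0 Ev Hv] := hw; have [v'0 Ev' Hv'] := hw'.
have sT := fspan_subspace D (eq (col_mx v v')).
have block0 (A : 'M[C]_m) (B : 'M[C]_n) w w' :
    block_mx A 0 0 B *m col_mx w w' = col_mx (A *m w) (B *m w') :> 'cV_(m + n).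
  by rewrite mul_block_col !mul0mx addr0 add0r.
have T00 : T 0 0 by rewrite /T col_mx0; apply: fspan0.
have Tlin c u u' w w' : T u u' -> T w w' -> T (c *: u + w) (c *: u' + w').
  by rewrite /T -add_col_mx -scale_col_mx; apply: fspan_linear.
have Tst p w w' : T w w' -> [/\ T (opE M p *m w) (opE M' p *m w'),
    T (opF M p *m w) (opF M' p *m w') & T (opH M p *m w) (opH M' p *m w')].
  rewrite /T -!block0 => Tw; apply: (@fspan_stable _ D) => // q _ <-.
    by rewrite block0 Ev Ev' col_mx0.
  by rewrite block0 Hv Hv' -scale_col_mx; apply: subspaceZ => //; apply: fspan_base.
have Tv : T v v' by apply: fspan_base.
have [phi [phiv phiF _]] := coordinate_along irrM hw m0.
have [phi' [phiv' phiF' _]] := coordinate_along irrM' hw' n0.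
have Tphi w w' : T w w' -> phi *m w = phi' *m w'.
  move=> /(@fspan_functional _ D _ (row_mx phi (- phi'))) => H.
  apply/eqP; rewrite -subr_eq0 -mulNmx -mul_row_col; apply/eqP; apply: H.
    by move=> p; rewrite mul_row_block !mulmx0 addr0 add0r mulNmx phiF phiF' oppr0 row_mx0.
  by move=> _ <-; rewrite mul_row_col mulNmx phiv phiv' subrr.
have one0 : (1%:M : 'M[C]_1) <> 0.
  by move=> /matrixP/(_ 0 0)/eqP; rewrite !mxE oner_eq0.
(* The [w'] with [T 0 w'] form a submodule. If it were nonzero it would contain [v'], but the
   coordinates of 0 and [v'] are 0 and 1. *)
have T0l w' : T 0 w' -> w' = 0.
  move=> Tw'; apply: contrapT => /eqP w'0; apply: one0.
  rewrite -phiv' -(Tphi 0 v') ?mulmx0 //.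
  apply: (irrM' (fun w' => T 0 w')); last by exists w'.
    by split=> // c u w Tu Tw; rewrite -[0](addr0) -{1}[0](scaler0 _ c); apply: Tlin.
  by move=> p w Tw; have [] := Tst p _ _ Tw; rewrite !mulmx0.
have T0r w : T w 0 -> w = 0.
  move=> Tw; apply: contrapT => /eqP w0; apply: one0.
  rewrite -phiv (Tphi v 0) ?mulmx0 //.
  apply: (irrM (fun w => T w 0)); last by exists w.
    by split=> // c x y Tx Ty; rewrite -[0](addr0) -{1}[0](scaler0 _ c); apply: Tlin.
  by move=> p y Ty; have [] := Tst p _ _ Ty; rewrite !mulmx0.
have TB u u' w w' : T u u' -> T w w' -> T (u - w) (u' - w').
  by move=> Tu Tw; rewrite addrC -scaleN1r (addrC u') -(scaleN1r w'); apply: Tlin.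
have surl w' : exists w, T w w'.
  apply: (irrM' (fun w' => exists w, T w w')); last by exists v'; split => //; exists v.
    split; first by exists 0.
    by move=> c u w [x xu] [y yw]; exists (c *: x + y); apply: Tlin.
  by move=> p w [x /(Tst p) [? ? ?]]; split; eexists; eassumption.
have surr w : exists w', T w w'.
  apply: (irrM (fun w => exists w', T w w')); last by exists v; split => //; exists v'.
    split; first by exists 0.
    by move=> c u x [y yu] [z zw]; exists (c *: y + z); apply: Tlin.
  by move=> p x [y /(Tst p) [? ? ?]]; split; eexists; eassumption.
have [f fP] := choice surl; have [g gP] := choice surr.
pose P : 'M[C]_(m, n) := \matrix_(i, j) f (delta_mx j 0) i 0.
pose Q : 'M[C]_(n, m) := \matrix_(i, j) g (delta_mx j 0) i 0.
have TP w' : T (P *m w') w'.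
  rewrite /T -{2}[w']mul1mx -mul_col_mx; apply: subspace_mulmx => // j.
  rewrite col_col_mx col1; have -> : col j P = f (delta_mx j 0) by apply/colP=> i; rewrite !mxE.
  exact: fP.
have TQ w : T w (Q *m w).
  rewrite /T -{1}[w]mul1mx -mul_col_mx; apply: subspace_mulmx => // j.
  rewrite col_col_mx col1; have -> : col j Q = g (delta_mx j 0) by apply/colP=> i; rewrite !mxE.
  exact: gP.
have uniql w w' x : T w w' -> T x w' -> w = x.
  by move=> Tw Tx; apply/eqP; rewrite -subr_eq0; apply/eqP/T0r; rewrite -(subrr w'); apply: TB.
have uniqr w w' x' : T w w' -> T w x' -> w' = x'.
  by move=> Tw Tx; apply/eqP; rewrite -subr_eq0; apply/eqP/T0l; rewrite -(subrr w); apply: TB.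
exists P, Q; split.
- by apply: mulmx_ext => w; rewrite mul1mx -mulmxA; apply: uniql (TP _) (TQ _).
- by apply: mulmx_ext => w; rewrite mul1mx -mulmxA; apply: uniqr (TQ _) (TP _).
- move=> p; split; apply: mulmx_ext => w; rewrite -!mulmxA; have [TE TF TH] := Tst p _ _ (TP w).
  + exact: uniql TE (TP _).
  + exact: uniql TF (TP _).
  + exact: uniql TH (TP _).
Qed.

End OnsagerModules.

(** * The shape of highest weights *)

Section LagrangePolynomials.
Variable C : fieldType.
Implicit Types (s : seq C) (c d : C).

(** Factors with [d = c] are skipped, so repetitions in [s] do no harm; [s] will also be a
    concatenation of two families of points. *)
Definition lagrange s c : {poly C} :=
  \prod_(d <- s | d != c) ((c - d)^-1 *: ('X - d%:P)).

Lemma lagrangeE s c d : d \in s -> (lagrange s c).[d] = (d == c)%:R.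
Proof.
move=> ds; rewrite horner_prod; have [->|dc] := eqVneq d c; last first.
  rewrite (big_rem d) //= dc hornerZ hornerXsubC subrr mulr0.
  by rewrite mul0r.
rewrite big1 // => e ec; rewrite hornerZ hornerXsubC mulVf // subr_eq0 eq_sym.
exact: ec.
Qed.

Lemma vanishing_dvdp s (p : {poly C}) : uniq s -> {in s, forall c, p.[c] = 0} ->
  exists q, p = \prod_(c <- s) ('X - c%:P) * q.
Proof.
move=> us ps; have /dvdpP [q ->] : \prod_(c <- s) ('X - c%:P) %| p.
  apply: uniq_roots_dvdp; last by rewrite uniq_rootsE.
  by apply/allP => c cs; apply/rootP/ps.
by exists q; rewrite mulrC.
Qed.

End LagrangePolynomials.

(** For [w k = F^k v] one has [E w(k+1) = (k+1)(nu - k tau) w(k)], and the scalar must vanish at the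
    first [k] with [w(k+1) = 0]. The step [tau] is left free: [tau = 0] forces [nu = 0], and a
    nonzero [tau] makes [nu / tau] a natural number. *)
Lemma weight_string (C : numClosedFieldType) m (E F Z : 'M[C]_m) (v : 'cV[C]_m) (nu tau : C) :
  v != 0 -> E *m v = 0 -> Z *m v = nu *: v ->
  E *m F = F *m E + Z -> Z *m F = F *m Z - (2 * tau) *: F ->
  (exists k, iter k (mulmx F) v = 0) -> exists k : nat, nu = tau *+ k.
Proof.
move=> v0 Ev Zv EF ZF nil; pose w k := iter k (mulmx F) v.
have Zw k : Z *m w k = (nu - tau *+ k *+ 2) *: w k.
  elim: k => [|k IH]; first by rewrite !mul0rn subr0.
  rewrite /w /= mulmxA ZF mulmxBl -mulmxA IH -scalemxAr -scalemxAl -scalerBl.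
  by congr (_ *: _); ring.
have Ew k : E *m w k.+1 = ((nu - tau *+ k) *+ k.+1) *: w k.
  elim: k => [|k IH].
    by rewrite /w /= mulmxA EF mulmxDl -mulmxA Ev mulmx0 add0r Zv mulr0n subr0 mulr1n.
  rewrite {1}/w iterS -/(w k.+1) mulmxA EF mulmxDl -mulmxA IH -scalemxAr Zw -scalerDl.
  by congr (_ *: _); rewrite -2![_ *+ k.+2]mulr_natr; ring.
have ex0 : exists k, w k == 0 by have [k wk] := nil; exists k; apply/eqP.
have [[|k] /eqP wk kmin] := ex_minnP ex0; first by rewrite /w /= in wk; rewrite wk eqxx in v0.
exists k; apply/eqP; rewrite -subr_eq0.
have /eqP := Ew k; rewrite wk mulmx0 eq_sym scaler_eq0 mulrn_eq0 /=.
by case/orP => // /kmin; rewrite ltnn.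
Qed.

Lemma uniq_rem_notin (T : eqType) (s : seq T) :
  (forall c, c \in s -> c \notin rem c s) -> uniq s.
Proof.
elim: s => //= a s IH H; have as' : a \notin s.
  by have := H a (mem_head a s); rewrite eqxx.
rewrite as' /=; apply: IH => c cs; have := H c; rewrite inE cs orbT => /(_ isT).
have ac : a != c by apply: contraNneq as' => ->.
by rewrite (negPf ac) inE negb_or => /andP [].
Qed.

(** * The radical ideal of a highest weight and its roots *)

Section HighestWeight.
Variables (C : numClosedFieldType) (m : nat) (M : onsager_module C m).
Variables (v : 'cV[C]_m) (lam : {poly C} -> C).
Hypotheses (m0 : (0 < m)%N) (irrM : op_irreducible M) (hw : highest_weight M v lam).
Implicit Types (p q r g : {poly C}).

(** As E_q F_p v = lam(disc p q) v, these are the [p] for which F_p v is killed by every raising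
    operator. *)
Definition in_radical p := forall q, lam (disc * p * q) = 0.

Lemma in_radicalM p q : in_radical p -> in_radical (p * q).
Proof. by move=> Jp r; rewrite mulrA -mulrA; have := Jp (q * r); rewrite !mulrA. Qed.

Lemma radical_acts_trivially p : in_radical p -> opE M p = 0 /\ opF M p = 0.
Proof.
move=> Jp; have [v0 Ev Hv] := hw.
(* Otherwise these vectors, killed by every [opE] and with a span stable under every [opH], generate
   the module; yet [phi] kills them all and [phi *m v] is 1. *)
have Fv q : opF M (p * q) *m v = 0.
  apply: contrapT => /eqP Fv0.
  have [phi [phiv phiF _]] := coordinate_along irrM hw m0.
  pose B w := exists q, w = opF M (p * q) *m v.
  have /eqP := phiv; rewrite (@fspan_functional _ _ M B phi) //.
  - by move=> /eqP/matrixP/(_ 0 0)/eqP; rewrite !mxE eq_sym oner_eq0.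
  - by move=> _ [r ->]; rewrite mulmxA phiF mul0mx.
  apply: (fspan_irreducible (b := opF M (p * q) *m v)) => //; last by exists q.
    move=> r _ [q' ->]; rewrite (raising_lowering _ _ hw).
    have -> : disc * r * (p * q') = disc * p * (r * q') by ring.
    by rewrite Jp scale0r.
  move=> r _ [q' ->]; rewrite mulmxA opHF mulmxBl -mulmxA Hv -scalemxAr -scalemxAl.
  have sB := fspan_subspace M B.
  apply: subspaceB => //; apply: subspaceZ => //; apply: fspan_base.
    by exists q'.
  by exists (r * q'); rewrite mulrCA.
(* The E_{pq}, F_{pq} and H_{disc p q} span an ideal, so the vectors they kill form a submodule; it
   contains [v]. *)
pose K (w : 'cV[C]_m) := forall q, [/\ opE M (p * q) *m w = 0, opF M (p * q) *m w = 0
   & opH M (disc * p * q) *m w = 0].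
have allK : forall w, K w.
  apply: irrM; last by exists v; split => // q; rewrite Ev Fv Hv Jp scale0r.
    split; first by move=> q; rewrite !mulmx0.
    move=> c u w Ku Kw q; have [e1 e2 e3] := Ku q; have [f1 f2 f3] := Kw q.
    by rewrite !mulmxDr -!scalemxAr e1 e2 e3 f1 f2 f3 scaler0 addr0.
  move=> r w Kw; split => q; have [Ew Fw Hw] := Kw q; have [Erw Frw Hrw] := Kw (r * q).
  - rewrite !mulmxA; split.
    + by rewrite opEE -mulmxA Ew mulmx0.
    + have /(canLR (addrK _)) <- := opEF M r (p * q); rewrite mulmxBl -mulmxA Fw mulmx0.
      have -> : disc * r * (p * q) = disc * p * (r * q) by ring.
      by rewrite Hrw subr0.
    + rewrite opHE mulmxDl -mulmxA Hw mulmx0 add0r -scalemxAl.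
      have [E' _ _] := Kw (disc * q * r).
      have -> : disc * p * q * r = p * (disc * q * r) by ring.
      by rewrite E' scaler0.
  - rewrite !mulmxA; split.
    + rewrite opEF mulmxDl -mulmxA Ew mulmx0 add0r.
      have -> : disc * (p * q) * r = disc * p * (r * q) by ring.
      by rewrite Hrw.
    + by rewrite opFF -mulmxA Fw mulmx0.
    + rewrite opHF mulmxBl -mulmxA Hw mulmx0 sub0r -scalemxAl.
      have [_ F' _] := Kw (disc * q * r).
      have -> : disc * p * q * r = p * (disc * q * r) by ring.
      by rewrite F' scaler0 oppr0.
  - rewrite !mulmxA; split.
    + have /(canLR (addrK _)) <- := opHE M r (p * q); rewrite mulmxBl -mulmxA Ew mulmx0 -scalemxAl.
      have -> : r * (p * q) = p * (r * q) by ring.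
      by rewrite Erw scaler0 subr0.
    + have /(canLR (subrK _)) <- := opHF M r (p * q); rewrite mulmxDl -mulmxA Fw mulmx0 -scalemxAl.
      have -> : r * (p * q) = p * (r * q) by ring.
      by rewrite Frw scaler0 addr0.
    + by rewrite opHH -mulmxA Hw mulmx0.
by split; apply: mulmx_ext => w; rewrite mul0mx; have := allK w 1; rewrite mulr1 => -[].
Qed.

(** The iterates have [opH M 1]-eigenvalues [lam 1 - 2 k]. *)
Lemma lowering_nilpotent p : exists k, iter k (mulmx (opF M p)) v = 0.
Proof.
have [_ _ Hv] := hw.
have n2 : - 2 != 0 :> C by rewrite oppr_eq0 pnatr_eq0.
apply: (@eigen_sequence_vanishes _ _ (opH M 1) (lam 1) (- 2) _ n2) => k.
elim: k => [|k IH]; first by rewrite mulr0n addr0 /= Hv.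
rewrite iterS mulmxA opHF mulmxBl -mulmxA IH mul1r -scalemxAr -scalemxAl -scalerBl.
by congr (_ *: _); rewrite [in RHS]mulrS; ring.
Qed.

(** The string of E_q, F_p and H_{disc p q} has step 0: the bracket of H with F_p is a multiple of F
    at [disc * (p * p) * q], which vanishes by hypothesis. So its top weight lam(disc p q) is 0. *)
Lemma in_radical_sqr p : in_radical (disc * (p * p)) -> in_radical p.
Proof.
move=> Jpp q; have [v0 Ev Hv] := hw.
have [||k ->] := @weight_string _ _ (opE M q) (opF M p) (opH M (disc * p * q)) v
  (lam (disc * p * q)) 0 v0 (Ev q) (Hv _) _ _ (lowering_nilpotent p); last by rewrite mul0rn.
  by rewrite opEF; congr (_ + opH M _); ring.
rewrite opHF mulr0 scale0r.
have -> : disc * p * q * p = disc * (p * p) * q by ring.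
by rewrite (radical_acts_trivially (in_radicalM q Jpp)).2 scaler0.
Qed.

Hypothesis trH : forall p, \tr (opH M p) = 0.

(** The brackets of H_p with the other operators are E and F at multiples of [p], hence 0. So H_p is
    the scalar [lam p], and its trace is [m] times that. *)
Lemma weight_radical p : in_radical p -> lam p = 0.
Proof.
move=> Jp; have [v0 Ev Hv] := hw.
have HpE (w : 'cV[C]_m) : opH M p *m w = lam p *: w.
  pose K (x : 'cV[C]_m) := opH M p *m x = lam p *: x.
  suff : K w by []; apply: irrM; last by exists v; split; [exact: Hv|].
    split; first by rewrite /K mulmx0 scaler0.
    by move=> c u x eu ex; rewrite /K mulmxDr -scalemxAr eu ex scalerDr !scalerA mulrC.
  move=> q {}w Hw; have [E0 F0] := radical_acts_trivially (in_radicalM q Jp).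
  rewrite /K !mulmxA opHE opHF opHH E0 F0 !scaler0 subr0 addr0 -!mulmxA Hw.
  by rewrite !scalemxAr.
have /eqP := trH p; have -> : opH M p = (lam p)%:M.
  apply/matrixP => i j; have /colP/(_ i) := HpE (delta_mx j 0).
  by rewrite -colE !mxE => ->; rewrite eqxx andbT mulr_natr.
by rewrite mxtrace_scalar mulrn_eq0 -leqn0 leqNgt m0 /= => /eqP.
Qed.

Lemma radical_nontrivial : exists2 g, g != 0 & in_radical g.
Proof.
have [_ Ev Hv] := hw.
(* These are [m.+1] vectors in dimension [m]; a linear relation between them is the list of
   coefficients of some [g] with F_g v = 0. *)
pose A : 'M[C]_(m.+1, m) := \matrix_(i < m.+1) (opF M 'X^i *m v)^T.
have [u uA u0] : exists2 u : 'rV_m.+1, u *m A = 0 & u != 0.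
  have : kermx A != 0.
    rewrite -mxrank_eq0 mxrank_ker subn_eq0 -ltnNge ltnS; exact: rank_leq_col.
  by case/rowV0Pn => u /sub_kermxP; exists u.
pose g := \poly_(i < m.+1) u 0 (inord i); exists g.
  apply: contra u0 => /eqP g0; apply/eqP/rowP => i.
  by have := coef_poly m.+1 (fun i => u 0 (inord i)) i; rewrite -/g g0 coef0 ltn_ord inord_val mxE.
have Fg : opF M g *m v = 0.
  have F0 : opF M 0 = 0.
    by have := opF_linear M (-1) 0 0; rewrite scaler0 addr0 scaleN1r addNr.
  have -> : opF M g = \sum_(i < m.+1) u 0 i *: opF M 'X^i.
    rewrite /g poly_def; under eq_bigr do rewrite inord_val.
    apply: (big_ind2 (fun p A => opF M p = A)) => // [p1 A1 p2 A2 <- <-|i _].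
      by rewrite -[p1]scale1r opF_linear !scale1r.
    by rewrite -[_ *: 'X^i]addr0 opF_linear F0 addr0.
  apply: trmx_inj; rewrite trmx0 -uA mulmx_suml linear_sum /= mulmx_sum_row.
  by apply: eq_bigr => i _; rewrite rowK -scalemxAl linearZ.
move=> q; apply/eqP; have [v0 _ _] := hw.
have : lam (disc * q * g) *: v == 0.
  by rewrite -(raising_lowering q g hw) Fg mulmx0.
by rewrite scaler_eq0 (negPf v0) orbF mulrAC.
Qed.

(** Take a shortest list of roots. If [c] were repeated or [c * c = 4], let [p] be the product with
    one [c] removed: [disc * (p * p)] is a multiple of the full product, so [p] is in the radical,
    against minimality. *)
Lemma radical_split : exists s : seq C,
  [/\ uniq s, 2 \notin s, - 2 \notin s & in_radical (\prod_(c <- s) ('X - c%:P))].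
Proof.
pose good k := `[< exists s : seq C, size s = k /\ in_radical (\prod_(c <- s) ('X - c%:P)) >].
have exg : exists k, good k.
  have [g g0 Jg] := radical_nontrivial; have [s gs] := closed_field_poly_normal g.
  exists (size s); apply/asboolP; exists s; split => //.
  have -> : \prod_(c <- s) ('X - c%:P) = g * (lead_coef g)^-1%:P.
    by rewrite [X in X * _]gs mulrC mul_polyC scalerA mulVf ?lead_coef_eq0 // scale1r.
  exact: in_radicalM.
have [k /asboolP [s [sk Js]] kmin] := ex_minnP exg.
have rm c : c \in s -> ~ in_radical (\prod_(d <- rem c s) ('X - d%:P)).
  move=> cs Jc; have : good (size s).-1.
    by apply/asboolP; exists (rem c s); rewrite size_rem.
  by move=> /kmin; rewrite -sk; case: (s) cs => //= a l _; rewrite ltnn.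
have disc2 (c : C) : c * c = 4 -> c \notin s.
  move=> c2; apply/negP => cs; apply: (rm c cs); apply: in_radical_sqr.
  have := in_radicalM (('X + c%:P) * \prod_(d <- rem c s) ('X - d%:P)) Js.
  rewrite (big_rem c) //=; congr in_radical; rewrite /disc -c2 polyCM expr2; ring.
exists s; split => //; last by apply: disc2; rewrite mulrNN -natrM.
  apply: uniq_rem_notin => c cs; apply/negP => crs; apply: (rm c cs).
  apply: in_radical_sqr; pose u := \prod_(d <- rem c (rem c s)) ('X - d%:P).
  have := in_radicalM (u * disc) Js.
  rewrite (big_rem c) //= (big_rem c crs) /= -/u; congr in_radical; ring.
by apply: disc2; rewrite -natrM.
Qed.

Lemma weight_shape : exists (s : seq C) (n : C -> nat),
  [/\ uniq s, 2 \notin s, - 2 \notin s &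
      forall p, lam p = \sum_(c <- s) (n c)%:R * p.[c]].
Proof.
have [s [us s2 sN2 Js]] := radical_split.
have vanish p : {in s, forall c, p.[c] = 0} -> in_radical p.
  by move=> /(vanishing_dvdp us) [q ->]; apply: in_radicalM.
have [v0 Ev Hv] := hw.
have natural c : c \in s -> exists k : nat, lam (lagrange s c) = k%:R.
  move=> cs; pose l := lagrange s c.
  (* Modulo the radical, [l] is idempotent and [disc * l] is [kap *: l]. So the string of E_l and
     F_l has top weight [kap * lam l] and step [kap], which is nonzero because [c] is neither 2 nor
     -2. *)
  pose kap : C := c ^+ 2 - 4.
  have kap0 : kap != 0.
    have -> : kap = (c - 2) * (c + 2) by rewrite /kap; ring.
    rewrite mulf_neq0 //.
      by rewrite subr_eq0; apply: contraNneq s2 => <-.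
    by rewrite addr_eq0; apply: contraNneq sN2 => <-.
  have lamz : lam (disc * l * l) = kap * lam l.
    have : lam (- kap *: l + disc * l * l) = 0.
      apply/weight_radical/vanish => d ds; rewrite /disc !hornerE !lagrangeE //.
      have [->|_] := eqVneq d c; rewrite /kap /= ?mulr1n ?mulr0n; ring.
    by rewrite (highest_weight_linear _ _ _ hw) => /eqP; rewrite mulNr addrC subr_eq0 => /eqP.
  have [|||k klam] := @weight_string _ _ (opE M l) (opF M l) (opH M (disc * l * l)) v
     (kap * lam l) kap v0 (Ev l) _ _ _ (lowering_nilpotent l).
  - by rewrite Hv lamz.
  - by rewrite opEF.
  - have : opF M (- kap *: l + disc * l * l * l) = 0.
      apply: (radical_acts_trivially _).2; apply: vanish => d ds.
      rewrite /disc !hornerE !lagrangeE //.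
      have [->|_] := eqVneq d c; rewrite /kap /= ?mulr1n ?mulr0n; ring.
    rewrite opF_linear addrC scaleNr => /eqP; rewrite subr_eq0 => /eqP e.
    by rewrite opHF e scalerA.
  by exists k; apply: (mulfI kap0); rewrite klam mulr_natr.
have [n nP] : exists n : C -> nat, forall c, c \in s -> lam (lagrange s c) = (n c)%:R.
  suff /choice [n nP] : forall c, exists k : nat, c \in s -> lam (lagrange s c) = k%:R.
    by exists n.
  move=> c.
  have [/natural [k kP]|cs] := boolP (c \in s); first by exists k.
  by exists 0%N.
exists s, n; split => // p.
have lam0 : lam 0 = 0.
  by have := highest_weight_linear (-1) 0 0 hw; rewrite scaler0 addr0 mulN1r addNr.
have lam_sum (r : seq C) (c : C -> C) :
    lam (\sum_(d <- r) c d *: lagrange s d) = \sum_(d <- r) c d * lam (lagrange s d).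
  elim: r => [|d r IH]; first by rewrite !big_nil.
  by rewrite !big_cons (highest_weight_linear _ _ _ hw) IH.
(* [p] and its interpolation polynomial differ by an element of the radical. *)
have : lam (- 1 *: (\sum_(d <- s) p.[d] *: lagrange s d) + p) = 0.
  apply/weight_radical/vanish => c cs; rewrite !hornerE horner_sum (big_rem c) //=.
  rewrite hornerZ lagrangeE // eqxx mulr1 big_seq big1 ?addr0; first by ring.
  move=> d; rewrite mem_rem_uniq // inE => /andP [dc ds].
  by rewrite hornerZ lagrangeE // eq_sym (negPf dc) mulr0.
rewrite (highest_weight_linear _ _ _ hw) mulN1r addrC => /eqP.
rewrite subr_eq0 lam_sum => /eqP ->.
by rewrite !big_seq; apply: eq_bigr => c cs; rewrite nP // mulrC.
Qed.

End HighestWeight.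

(** * The triangular form of the Onsager algebra *)

Definition horner_simp := (hornerD, hornerN, hornerM, hornerZ, hornerC, hornerX, hornerXn).

Section TriangularForm.
Variable C : numClosedFieldType.
Implicit Types (p q r : {poly C}) (a c x y z : C).

Definition sl2_mat x y z : 'M[C]_2 := x *: sl2_e C + y *: sl2_f C + z *: sl2_h C.

Lemma sl2_mat_linear c x y z x' y' z' :
  c *: sl2_mat x y z + sl2_mat x' y' z' = sl2_mat (c * x + x') (c * y + y') (c * z + z').
Proof. by apply/matrixP => i j; rewrite !mxE; ring. Qed.

Lemma sl2_mat_bracket x y z x' y' z' :
  sl2_mat x y z *m sl2_mat x' y' z' - sl2_mat x' y' z' *m sl2_mat x y z =
  sl2_mat (2 * (z * x' - z' * x)) (2 * (y * z' - y' * z)) (x * y' - x' * y).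
Proof.
apply/matrixP => i j; rewrite !mxE !big_ord_recl !big_ord0 !mxE /=.
by case: i => [[|[|i]] //= ?]; case: j => [[|[|j]] //= ?]; rewrite /=; ring.
Qed.

(* With [x = t + t^-1] and [d = t - t^-1], the element
   [p(x) (e+f) + d q(x) (e-f-h)/2 - d r(x) (e-f+h)/2]:
   [(e+f, (e-f-h)/2, -(e-f+h)/2)] is an sl_2-triple whose Cartan element is the
   fixed vector [e+f], and [d^2 = x^2 - 4]. *)
Definition OA_triple p q r : C -> 'M[C]_2 :=
  OAelt (fun a => p.[a + a^-1] + (a - a^-1) * (q - r).[a + a^-1] / 2)
        (fun a => - ((a - a^-1) * (q + r).[a + a^-1] / 2)).

Lemma OA_tripleE p q r a : a != 0 -> OA_triple p q r a =
  sl2_mat (p.[a + a^-1] + (a - a^-1) * (q - r).[a + a^-1] / 2)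
          (p.[a + a^-1] - (a - a^-1) * (q - r).[a + a^-1] / 2)
          (- ((a - a^-1) * (q + r).[a + a^-1] / 2)).
Proof.
move=> a0; rewrite /OA_triple /OAelt (negPf a0) invrK [a^-1 + a]addrC.
by rewrite -[a^-1 - a]opprB mulNr mulNr.
Qed.

Lemma OA_triple0 p q r : OA_triple p q r 0 = 0.
Proof. by rewrite /OA_triple /OAelt eqxx. Qed.

Lemma OA_triple_linear c p q r p' q' r' :
  OA_triple (c *: p + p') (c *: q + q') (c *: r + r') =
  (fun a => c *: OA_triple p q r a + OA_triple p' q' r' a).
Proof.
apply: funext => a; have [->|a0] := eqVneq a 0.
  by rewrite !OA_triple0 scaler0 addr0.
rewrite !OA_tripleE // sl2_mat_linear; congr sl2_mat; rewrite !horner_simp; ring.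
Qed.

Lemma OA_triple_bracket p q r p' q' r' :
  OA_triple (disc * (q * r' - q' * r)) (2 *: (p * q' - p' * q)) (- 2 *: (p * r' - p' * r)) =
  (fun a => OA_triple p q r a *m OA_triple p' q' r' a
            - OA_triple p' q' r' a *m OA_triple p q r a).
Proof.
apply: funext => a; have [->|a0] := eqVneq a 0.
  by rewrite !OA_triple0 mulmx0 subr0.
rewrite !OA_tripleE // sl2_mat_bracket; congr sl2_mat; rewrite /disc !horner_simp; field.
all: by rewrite a0.
Qed.

Lemma laurentD (f g : C -> C) : is_laurent f -> is_laurent g -> is_laurent (fun a => f a + g a).
Proof.
move=> [N [P fP]] [K [Q gQ]]; exists (N + K)%N, (P * 'X^K + Q * 'X^N) => a a0.
rewrite fP // gQ // !horner_simp exprD; field.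
by rewrite !expf_neq0.
Qed.

Lemma laurentM (f g : C -> C) : is_laurent f -> is_laurent g -> is_laurent (fun a => f a * g a).
Proof.
move=> [N [P fP]] [K [Q gQ]]; exists (N + K)%N, (P * Q) => a a0.
rewrite fP // gQ // !horner_simp exprD; field.
by rewrite !expf_neq0.
Qed.

Lemma laurent_cst c : is_laurent (fun _ : C => c).
Proof. by exists 0%N, c%:P => a _; rewrite hornerC expr0 divr1. Qed.

Lemma laurent_id : is_laurent (fun a : C => a).
Proof. by exists 0%N, 'X => a _; rewrite hornerX expr0 divr1. Qed.

Lemma laurent_inv : is_laurent (fun a : C => a^-1).
Proof. by exists 1%N, 1 => a _; rewrite hornerC expr1 mul1r. Qed.

Lemma laurent_horner p (f : C -> C) : is_laurent f -> is_laurent (fun a => p.[f a]).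
Proof.
move=> Lf; elim/poly_ind: p => [|p c Lp].
  have -> : (fun a => (0 : {poly C}).[f a]) = fun=> 0 by apply: funext => a; rewrite horner0.
  exact: laurent_cst.
have -> : (fun a => (p * 'X + c%:P).[f a]) = fun a => p.[f a] * f a + c.
  by apply: funext => a; rewrite !horner_simp.
by apply: laurentD; [exact: laurentM | exact: laurent_cst].
Qed.

Lemma OA_triple_in p q r : in_OA (OA_triple p q r).
Proof.
have Lx : is_laurent (fun a : C => a + a^-1) := laurentD laurent_id laurent_inv.
have Ld : is_laurent (fun a : C => a - a^-1).
  have -> : (fun a : C => a - a^-1) = fun a => a + (-1) * a^-1.
    by apply: funext => a; rewrite mulN1r.
  apply: laurentD; first exact: laurent_id.
  by apply: laurentM; [exact: laurent_cst | exact: laurent_inv].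
have Lm u : is_laurent (fun a => (a - a^-1) * u.[a + a^-1] / 2).
  by apply: laurentM; [apply: laurentM => //; exact: laurent_horner | exact: laurent_cst].
eexists; eexists; split; last by [].
- by apply: laurentD; [exact: laurent_horner | exact: Lm].
- have -> : (fun a => - ((a - a^-1) * (q + r).[a + a^-1] / 2))
          = fun a => (a - a^-1) * (- (q + r)).[a + a^-1] / 2.
    by apply: funext => a; rewrite hornerN mulrN mulNr.
  exact: Lm.
- move=> a a0 /=; rewrite invrK [a^-1 + a]addrC -[a^-1 - a]opprB; ring.
Qed.

(** With x = t + t^-1 and d = t - t^-1, the sums p(x) + d q(x) are closed under multiplication by t
    = (x+d)/2 and t^-1 = (x-d)/2, because d^2 is [disc] at x. *)
Lemma laurent_split (f : C -> C) : is_laurent f -> exists p q,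
  forall a, a != 0 -> f a = p.[a + a^-1] + (a - a^-1) * q.[a + a^-1].
Proof.
move=> [N [P fP]].
pose S (g : C -> C) := exists p q,
  forall a, a != 0 -> g a = p.[a + a^-1] + (a - a^-1) * q.[a + a^-1].
suff [p [q H]] : S (fun a => P.[a] / a ^+ N) by exists p, q => a a0; rewrite fP // H.
have n2 : 2 != 0 :> C by rewrite pnatr_eq0.
have Sid g : S g -> S (fun a => g a * a).
  move=> [p [q H]]; exists (2^-1 *: (p * 'X + disc * q)), (2^-1 *: (p + q * 'X)) => a a0.
  by rewrite H // /disc !horner_simp; field; rewrite a0.
have Sinv g : S g -> S (fun a => g a / a).
  move=> [p [q H]]; exists (2^-1 *: (p * 'X - disc * q)), (2^-1 *: (- p + q * 'X)) => a a0.
  by rewrite H // /disc !horner_simp; field; rewrite a0.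
clear fP; elim: N => [|N [p [q H]]]; last first.
  have [|p' [q' H']] := @Sinv (fun a => P.[a] / a ^+ N); first by exists p, q.
  exists p', q' => a a0; rewrite -H' // exprS; field.
  by rewrite a0 expf_neq0.
elim/poly_ind: P => [|P c [p [q H]]].
  by exists 0, 0 => a _; rewrite !horner0 mul0r mulr0 addr0.
have [|p' [q' H']] := @Sid (fun a => P.[a] / a ^+ 0); first by exists p, q.
by exists (p' + c%:P), q' => a a0; move: (H' a a0); rewrite !horner_simp expr0 !divr1 => ->; ring.
Qed.

Lemma in_OA_triple X : in_OA X -> exists p q r, X = OA_triple p q r.
Proof.
move=> [f [g [Lf Lg gV ->]]].
have [p [u fE]] := laurent_split Lf; have [b [w gE]] := laurent_split Lg.
(* The last two witnesses solve (q-r)/2 = u and -(q+r)/2 = w. *)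
exists p, (u - w), (- u - w); apply: funext => a.
have [->|a0] := eqVneq a 0; first by rewrite OA_triple0 /OAelt eqxx.
have n2 : 2 != 0 :> C by rewrite pnatr_eq0.
(* Antisymmetry under inversion kills the even part [b] of [g]. *)
have gw : g a = (a - a^-1) * w.[a + a^-1].
  have := gV a a0; rewrite gE ?invr_eq0 // invrK gE // [a^-1 + a]addrC => e.
  have b0 : b.[a + a^-1] = 0.
    apply: (mulfI n2); rewrite mulr0; move/eqP: e; rewrite -subr_eq0 => /eqP e.
    by rewrite -[RHS]e; ring.
  by rewrite b0 add0r.
rewrite OA_tripleE // /OAelt (negPf a0) gw fE // fE ?invr_eq0 // invrK [a^-1 + a]addrC.
by congr sl2_mat; rewrite !horner_simp; field; rewrite a0.
Qed.

(** * From representations of the Onsager algebra to modules *)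

Section ModuleOfRep.
Variables (m : nat) (rho : OA_rep C m).
Hypothesis repr : is_sl_rep rho.

Lemma rho_linear c p q r p' q' r' :
  rho (OA_triple (c *: p + p') (c *: q + q') (c *: r + r')) =
  c *: rho (OA_triple p q r) + rho (OA_triple p' q' r').
Proof. by have [lin _ _] := repr; rewrite OA_triple_linear lin //; apply: OA_triple_in. Qed.

Lemma rho_bracket p q r p' q' r' :
  rho (OA_triple p q r) *m rho (OA_triple p' q' r') =
  rho (OA_triple p' q' r') *m rho (OA_triple p q r) +
  rho (OA_triple (disc * (q * r' - q' * r)) (2 *: (p * q' - p' * q)) (- 2 *: (p * r' - p' * r))).
Proof.
have [_ br _] := repr; rewrite OA_triple_bracket br; try exact: OA_triple_in.
by rewrite addrC subrK.
Qed.

Lemma rho_triple0 : rho (OA_triple 0 0 0) = 0.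
Proof.
have := rho_linear (-1) 0 0 0 0 0 0.
by rewrite !scaler0 !addr0 scaleN1r addNr.
Qed.

Lemma rho_tripleZ c p q r :
  rho (OA_triple (c *: p) (c *: q) (c *: r)) = c *: rho (OA_triple p q r).
Proof. by have := rho_linear c p q r 0 0 0; rewrite !addr0 rho_triple0 addr0. Qed.

Lemma rho_tripleE p q r : rho (OA_triple p q r) =
  rho (OA_triple p 0 0) + rho (OA_triple 0 q 0) + rho (OA_triple 0 0 r).
Proof.
rewrite -[rho (OA_triple p 0 0)]scale1r -rho_linear -[X in X + _]scale1r -rho_linear.
by rewrite !scale1r !addr0 !add0r.
Qed.

Definition module_of_rep : onsager_module C m.
Proof.
refine (@OnsagerModule C m (fun p => rho (OA_triple 0 p 0)) (fun p => rho (OA_triple 0 0 p))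
  (fun p => rho (OA_triple p 0 0)) _ _ _ _ _ _ _ _ _).
- by move=> c p q; rewrite -rho_linear scaler0 addr0.
- by move=> c p q; rewrite -rho_linear scaler0 addr0.
- by move=> c p q; rewrite -rho_linear scaler0 addr0.
- by move=> p q; rewrite rho_bracket !(mulr0, mul0r, subr0, scaler0) rho_triple0 addr0.
- by move=> p q; rewrite rho_bracket !(mulr0, mul0r, subr0, scaler0) rho_triple0 addr0.
- by move=> p q; rewrite rho_bracket !(mulr0, mul0r, subr0, scaler0) rho_triple0 addr0.
- move=> r p; rewrite rho_bracket !(mulr0, mul0r, subr0, scaler0); congr (_ + _).
  by rewrite -rho_tripleZ !scaler0.
- move=> r p; rewrite rho_bracket !(mulr0, mul0r, subr0, scaler0); congr (_ + _).
  by rewrite -scaleNr -rho_tripleZ !scaler0.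
- move=> p q; rewrite rho_bracket !(mulr0, mul0r, subr0, scaler0) mulrA //.
Defined.

Lemma rho_module X : in_OA X -> exists p q r, rho X =
  opH module_of_rep p + opE module_of_rep q + opF module_of_rep r.
Proof. by move=> /in_OA_triple [p [q [r ->]]]; exists p, q, r; rewrite rho_tripleE. Qed.

Lemma module_of_rep_stable P : op_stable module_of_rep P -> subspace P ->
  forall X v, in_OA X -> P v -> P (rho X *m v).
Proof.
move=> stP sP X v /rho_module [p [q [r ->]]] Pv; rewrite !mulmxDl.
have [_ _ PH] := stP p _ Pv; have [PE _ _] := stP q _ Pv; have [_ PF _] := stP r _ Pv.
by apply: subspaceD => //; apply: subspaceD.
Qed.

Lemma module_of_rep_trace p : \tr (opH module_of_rep p) = 0.
Proof. by have [_ _ tr0] := repr; apply: tr0; apply: OA_triple_in. Qed.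

Lemma module_of_rep_irreducible : rep_irreducible rho <-> (0 < m)%N /\ op_irreducible module_of_rep.
Proof.
split=> [[m0 irr]|[m0 irr]]; split => //.
  move=> P sP stP [v [Pv v0]].
  have [W PW] := subspace_rowmx sP.
  have [|W0|Wm] := irr W^T.
  - move=> X inX; have /submxP [Z WZ] : (W *m (rho X)^T <= W)%MS.
      apply/row_subP => i; rewrite row_mul -[row i W]trmxK -trmx_mul -PW.
      have Pi : P (row i W)^T by rewrite PW trmxK row_sub.
      exact: module_of_rep_stable.
    by exists Z^T; rewrite -trmx_mul -WZ trmx_mul trmxK.
  - move: Pv; rewrite PW; have -> : W = 0 by apply: trmx_inj; rewrite W0 trmx0.
    by move=> /submx0null /eqP; rewrite trmx_eq0 (negPf v0).
  - by move=> w; rewrite PW submx_full // /row_full -mxrank_tr Wm.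
move=> W Winv; have [->|W0] := eqVneq W 0; [by left|right].
pose P (v : 'cV[C]_m) := (v^T <= W^T)%MS.
have sP : subspace P.
  split; first by rewrite /P trmx0 sub0mx.
  by move=> c u w Pu Pw; rewrite /P linearP /= addmx_sub // scalemx_sub.
have stP X v : in_OA X -> P v -> P (rho X *m v).
  move=> /Winv [Z XW]; rewrite /P => /submxP [b vb]; rewrite trmx_mul vb -mulmxA.
  by rewrite -trmx_mul XW trmx_mul mulmxA submxMl.
have allP : forall v, P v.
  apply: irr => // [p v Pv|].
    by split; apply: stP => //; apply: OA_triple_in.
  have /rowV0Pn [u uW u0] : W^T != 0 by rewrite trmx_eq0.
  by exists u^T; rewrite /P trmxK trmx_eq0.
rewrite -mxrank_tr; apply/eqP; rewrite -[_ == m]/(row_full W^T) -sub1mx.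
by apply/row_subP => i; rewrite -[row i _]trmxK; apply: allP.
Qed.

End ModuleOfRep.

Lemma module_intertwines m n (rho : OA_rep C m) (rho' : OA_rep C n)
    (repr : is_sl_rep rho) (repr' : is_sl_rep rho') (P : 'M[C]_(m, n)) :
  intertwines (module_of_rep repr) (module_of_rep repr') P <->
  forall X, in_OA X -> rho X *m P = P *m rho' X.
Proof.
split=> [iP X /in_OA_triple [p [q [r ->]]]|iP p].
  rewrite (rho_tripleE repr) (rho_tripleE repr') !mulmxDl !mulmxDr.
  have [_ _ /= ->] := iP p; have [/= -> _ _] := iP q; have [_ /= -> _] := iP r.
  by [].
by split; apply: iP; apply: OA_triple_in.
Qed.
End TriangularForm.

(** * The modules V(s) and operators on tensor slots *)

Section SpinMatrices.
Variables (C : numClosedFieldType) (d : nat).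
Local Notation e := (spin_e C d).
Local Notation f := (spin_f C d).
Local Notation h := (spin_h C d).

(** At [i = d] the index [inord i.+1] is a default value, harmless because the factor [d - i] is
    0. *)
Lemma spin_e_mul n (A : 'M[C]_(d.+1, n)) i k :
  (e *m A) i k = (i.+1 * (d - i))%:R * A (inord i.+1) k.
Proof.
rewrite mxE; have [id|di] := ltnP i d; last first.
  rewrite (_ : d - i = 0)%N; last by apply/eqP; rewrite subn_eq0.
  rewrite muln0 mul0r big1 // => j _; rewrite mxE; case: eqP => [ji|]; last by rewrite mul0r.
  by have := ltn_ord j; rewrite ji ltnS ltnNge di.
rewrite (bigD1 (inord i.+1)) //= big1 => [|j ji].
  by rewrite addr0 mxE inordK // eqxx subSS.
rewrite mxE; case: eqP => [jE|_]; last by rewrite mul0r.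
by case/eqP: ji; apply: val_inj; rewrite /= inordK // -jE.
Qed.

Lemma spin_f_mul n (A : 'M[C]_(d.+1, n)) i k :
  (f *m A) i k = if i == 0 :> nat then 0 else A (inord i.-1) k.
Proof.
rewrite mxE; case: eqP => [i0|/eqP i0].
  by rewrite big1 // => j _; rewrite mxE i0 mul0r.
have iE : (inord i.-1 : 'I_d.+1) = i.-1 :> nat.
  by rewrite inordK // (leq_ltn_trans (leq_pred i)).
rewrite (bigD1 (inord i.-1)) //= big1 => [|j ji].
  by rewrite addr0 mxE iE prednK ?lt0n // eqxx mul1r.
rewrite mxE; case: eqP => [jE|_]; last by rewrite mul0r.
by case/eqP: ji; apply: val_inj; rewrite /= iE jE.
Qed.

Lemma spin_h_mul n (A : 'M[C]_(d.+1, n)) i k :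
  (h *m A) i k = (d%:R - 2 * (i : nat)%:R) * A i k.
Proof.
rewrite mxE (bigD1 i) //= big1 => [|j ji]; first by rewrite addr0 mxE eqxx.
by rewrite mxE eq_sym (negPf ji) mul0r.
Qed.

Lemma mul_spin_h n (A : 'M[C]_(n, d.+1)) i k :
  (A *m h) i k = A i k * (d%:R - 2 * (k : nat)%:R).
Proof.
rewrite mxE (bigD1 k) //= big1 => [|j jk]; first by rewrite addr0 mxE eqxx.
by rewrite mxE (negPf jk) mulr0.
Qed.

Lemma spin_ef_mul (w : 'cV[C]_d.+1) i k :
  (e *m (f *m w)) i k = (i.+1 * (d - i))%:R * w i k.
Proof.
rewrite spin_e_mul spin_f_mul; have [id|di] := ltnP i d.
  by rewrite inordK //= inord_val.
by rewrite (eqP (_ : d - i == 0)%N) ?subn_eq0 // muln0 !mul0r.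
Qed.

Lemma spin_fe_mul (w : 'cV[C]_d.+1) i k :
  (f *m (e *m w)) i k = (i * (d.+1 - i))%:R * w i k.
Proof.
rewrite spin_f_mul; case: eqP => [->|/eqP i0]; first by rewrite mul0n mul0r.
rewrite spin_e_mul inordK ?(leq_ltn_trans (leq_pred i)) // prednK ?lt0n // inord_val.
by congr ((_ * _)%:R * _); rewrite -{2}(prednK (_ : 0 < i)%N) ?lt0n.
Qed.

Lemma spin_ef : e *m f = f *m e + h.
Proof.
apply: mulmx_ext => w; apply/colP => i; rewrite mulmxDl -!mulmxA [RHS]mxE.
rewrite spin_ef_mul spin_fe_mul spin_h_mul -mulrDl; congr (_ * _).
have id : (i <= d)%N by rewrite -ltnS.
by rewrite subSn // -[in d%:R](subnK id) !natrM natrD -!natr1; ring.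
Qed.

Lemma spin_he : h *m e = e *m h + 2 *: e.
Proof.
apply/matrixP => i k; rewrite spin_h_mul [RHS]mxE mul_spin_h !mxE.
by case: eqP => [->|_]; [rewrite -natr1; ring | rewrite !mulr0 mul0r addr0].
Qed.

Lemma spin_hf : h *m f = f *m h - 2 *: f.
Proof.
apply/matrixP => i k; rewrite spin_h_mul [RHS]mxE mul_spin_h !mxE.
by case: eqP => [->|_]; [rewrite -natr1; ring | rewrite !mulr0 mul0r subr0].
Qed.

Lemma spin_matE (x y z : C) : spin_mat d (sl2_mat x y z) = x *: e + y *: f + z *: h.
Proof.
rewrite /spin_mat; congr (_ *: _ + _ *: _ + _ *: _); rewrite !mxE /=; ring.
Qed.

Lemma spin_mat_linear c (A B : 'M[C]_2) :
  spin_mat d (c *: A + B) = c *: spin_mat d A + spin_mat d B.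
Proof. by apply/matrixP => i j; rewrite !mxE; ring. Qed.

(** [spin_mat] reads only the upper left diagonal entry, so it respects brackets of traceless
    matrices but not of arbitrary ones. *)
Lemma spin_mat_bracket (x y z x' y' z' : C) (A := sl2_mat x y z) (B := sl2_mat x' y' z') :
  spin_mat d (A *m B - B *m A) =
  spin_mat d A *m spin_mat d B - spin_mat d B *m spin_mat d A.
Proof.
rewrite /A /B sl2_mat_bracket !spin_matE !mulmxDl !mulmxDr -!scalemxAl -!scalemxAr.
rewrite spin_ef spin_he spin_hf.
move: (e *m e) (f *m f) (h *m h) (f *m e) (e *m h) (f *m h) => ee ff hh fe eh fh.
by apply/matrixP => i j; rewrite !mxE; ring.
Qed.

(* [(x+y)^d] in the model of [V(d/2)] by binary forms. *)
Definition spin_hw : 'cV[C]_d.+1 := \col_k (k`!)%:R^-1.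

Lemma natr_fact_neq0 (k : nat) : (k`!)%:R != 0 :> C.
Proof. by rewrite pnatr_eq0 -lt0n fact_gt0. Qed.

Lemma spin_e_hw i : (e *m spin_hw) i 0 = (d%:R - i%:R) * spin_hw i 0.
Proof.
rewrite spin_e_mul !mxE; have [id|di] := ltnP i d; last first.
  have -> : i = d :> nat by apply/eqP; rewrite eqn_leq di -ltnS ltn_ord.
  by rewrite subnn muln0 subrr !mul0r.
have i0 : i.+1%:R != 0 :> C by rewrite pnatr_eq0.
rewrite inordK // factS !natrM natrB 1?ltnW //; field.
by rewrite nat1r i0 natr_fact_neq0.
Qed.

Lemma spin_f_hw i : (f *m spin_hw) i 0 = i%:R * spin_hw i 0.
Proof.
rewrite spin_f_mul !mxE; case: eqP => [->|/eqP i0]; first by rewrite mul0r.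
have iE : (i : nat) = i.-1.+1 by rewrite prednK ?lt0n.
rewrite inordK ?(leq_ltn_trans (leq_pred i)) // [in RHS]iE factS natrM.
have n0 : i.-1.+1%:R != 0 :> C by rewrite pnatr_eq0.
by field; rewrite nat1r n0 natr_fact_neq0.
Qed.

Lemma spin_hw_weight : spin_mat d (sl2_mat 1 1 0) *m spin_hw = d%:R *: spin_hw.
Proof.
apply/colP => i; rewrite spin_matE !scale1r scale0r addr0 mulmxDl mxE.
by rewrite spin_e_hw spin_f_hw [RHS]mxE; ring.
Qed.

Lemma spin_hw_raise : spin_mat d (sl2_mat 2^-1 (- 2^-1) (- 2^-1)) *m spin_hw = 0.
Proof.
apply/colP => i; rewrite spin_matE !mulmxDl -!scalemxAl [LHS]mxE [X in X + _]mxE.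
rewrite [X in X + _ + _]mxE [X in _ + X + _]mxE [X in _ + X]mxE.
by rewrite spin_e_hw spin_f_hw spin_h_mul [RHS]mxE; field.
Qed.

(** [e^d] is a nonzero multiple of the matrix unit at (0, d). Multiplying by [f] on the left
    increases the row index and on the right decreases the column index, which reaches every matrix
    unit. *)
Lemma spin_generate (Q : 'M[C]_d.+1 -> Prop) : (0 < d)%N -> Q e -> Q f ->
  (forall c A B, Q A -> Q B -> Q (c *: A + B)) ->
  (forall A B, Q A -> Q B -> Q (A *m B)) -> forall A, Q A.
Proof.
move=> d0 Qe Qf Qlin Qmul.
have Q0 : Q 0 by have := Qlin (-1) e e Qe Qe; rewrite scaleN1r addNr.
have QZ c A : Q A -> Q (c *: A) by move=> QA; rewrite -[_ *: _]addr0; apply: Qlin.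
have powE k : exists c : nat -> C, (forall i, (i + k <= d)%N -> c i != 0) /\
    forall i j : 'I_d.+1, iter k (mulmx e) 1%:M i j = if j == (i + k)%N :> nat then c i else 0.
  elim: k => [|k [c [c0 cE]]].
    exists (fun=> 1); split => [i _|i j]; first exact: oner_neq0.
    by rewrite mxE addn0 -val_eqE /= eq_sym; case: eqP.
  exists (fun i => (i.+1 * (d - i))%:R * c i.+1); split => [i ik|i j].
    rewrite mulf_neq0 ?c0 ?addSnnS // pnatr_eq0 muln_eq0 /= subn_eq0 -ltnNge.
    by apply: leq_trans ik; rewrite addnS ltnS leq_addr.
  rewrite iterS spin_e_mul cE; have [id|di] := ltnP i d.
    by rewrite inordK // addSnnS; case: eqP => // _; rewrite mulr0.
  rewrite (_ : d - i = 0)%N; last by apply/eqP; rewrite subn_eq0.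
  by rewrite muln0 !mul0r; case: eqP.
have Qpow k : Q (iter k.+1 (mulmx e) 1%:M).
  elim: k => [|k IH]; first by rewrite /= mulmx1.
  by rewrite iterS; apply: Qmul.
have Q0d : Q (delta_mx ord0 ord_max).
  have [c [c0 cE]] := powE d; have := QZ (c 0%N)^-1 _ (Qpow d.-1).
  rewrite prednK //; congr Q; apply/matrixP => i j; rewrite [LHS]mxE cE mxE.
  rewrite -!val_eqE /=; case: (eqVneq (i : nat) 0%N) => [->|i0] /=.
    by rewrite add0n; case: eqP => _; rewrite ?mulr0 // mulVf // c0.
  case: eqP => [jE|]; last by rewrite mulr0.
  by have := ltn_ord j; rewrite jE ltnS -[X in (_ <= X)%N]add0n leq_add2r leqn0 (negPf i0).
have Qxd x : (x <= d)%N -> Q (delta_mx (inord x) ord_max).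
  elim: x => [_|x IH xd].
    by have -> : inord 0 = ord0 :> 'I_d.+1 by apply: val_inj; rewrite /= inordK.
  have := Qmul _ _ Qf (IH (ltnW xd)); congr Q; apply/matrixP => i j.
  rewrite spin_f_mul !mxE -!val_eqE /= !inordK //; last 2 first.
  - exact: ltnW.
  - by rewrite (leq_ltn_trans (leq_pred i)).
  by case: (i : nat) => [|i'] //=; rewrite eqSS.
have mul_f (A : 'M[C]_d.+1) i k : (A *m f) i k = if (k < d)%N then A i (inord k.+1) else 0.
  rewrite mxE; case: ltnP => kd; last first.
    rewrite big1 // => j _; rewrite mxE; case: eqP => [jk|]; last by rewrite mulr0.
    by have := ltn_ord j; rewrite jk ltnS ltnNge kd.
  rewrite (bigD1 (inord k.+1)) //= big1 => [|j jk].
    by rewrite addr0 mxE inordK // eqxx mulr1.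
  rewrite mxE; case: eqP => [jE|_]; last by rewrite mulr0.
  by case/eqP: jk; apply: val_inj; rewrite /= inordK.
have Qxy y x : (x <= d)%N -> (y <= d)%N -> Q (delta_mx (inord x) (inord (d - y))).
  move=> xd; elim: y => [_|y IH yd].
    rewrite subn0; have -> : inord d = ord_max :> 'I_d.+1 by apply: val_inj; rewrite /= inordK.
    exact: Qxd.
  have := Qmul _ _ (IH (ltnW yd)) Qf; congr Q; apply/matrixP => i j.
  rewrite mul_f !mxE -!val_eqE /=.
  have yE : (d - y = (d - y.+1).+1)%N by rewrite subnSK.
  rewrite (inordK (_ : d - y < d.+1)%N) ?ltnS ?leq_subr //.
  rewrite (inordK (_ : d - y.+1 < d.+1)%N) ?ltnS ?leq_subr //.
  case: ltnP => jd; first by rewrite (inordK (_ : j.+1 < d.+1)%N) // yE eqSS.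
  case: eqP => //= _; case: eqP => //= jE.
  by move: jd; rewrite jE leqNgt ltn_subrL d0.
move=> A; rewrite [A]matrix_sum_delta.
have Qsum (I : Type) (r : seq I) (F : I -> 'M[C]_d.+1) :
    (forall i, Q (F i)) -> Q (\sum_(i <- r) F i).
  by move=> QF; elim/big_ind: _ => // u v Qu Qv; rewrite -[u]scale1r; apply: Qlin.
apply: (Qsum) => i; apply: (Qsum) => j; apply: QZ.
have id : (i <= d)%N by rewrite -ltnS.
have jd : (j <= d)%N by rewrite -ltnS.
by have := Qxy (d - j)%N i id (leq_subr _ _); rewrite subKn // !inord_val.
Qed.

End SpinMatrices.

Section TensorOperators.
Variables (C : numClosedFieldType) (n : nat) (ss : 'I_n -> nat).
Local Notation T := (TT ss).

Definition update (t : T) j (x : 'I_(ss j).+1) : T := finfun (dfwith (fun l => t l) x).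

Lemma update_same t j (x : 'I_(ss j).+1) : update t x j = x.
Proof. by rewrite ffunE dfwith_in. Qed.

Lemma update_other t j (x : 'I_(ss j).+1) l : j != l -> update t x l = t l.
Proof. by move=> jl; rewrite ffunE dfwith_out. Qed.

Lemma update_update t j (x y : 'I_(ss j).+1) : update (update t x) y = update t y.
Proof.
apply/ffunP => l; have [<-|jl] := eqVneq j l; first by rewrite !update_same.
by rewrite !update_other.
Qed.

Lemma update_swap t j l (x : 'I_(ss j).+1) (y : 'I_(ss l).+1) : j != l ->
  update (update t x) y = update (update t y) x.
Proof.
move=> jl; apply/ffunP => k; have [<-|jk] := eqVneq j k.
  by rewrite update_other 1?eq_sym // !update_same.
have [<-|lk] := eqVneq l k; first by rewrite update_same update_other // update_same.
by rewrite !update_other.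
Qed.

Definition slot_op j (A : 'M[C]_((ss j).+1)) : 'M[C]_#|T| :=
  \matrix_(i, k) (if [forall l, (l != j) ==> (tidx i l == tidx k l)]
                  then A (tidx i j) (tidx k j) else 0).

Lemma rhoASE (a : 'I_n -> C) X :
  rhoAS a ss X = \sum_j slot_op (spin_mat (ss j) (X (a j))).
Proof.
by apply/matrixP => i k; rewrite mxE summxE; apply: eq_bigr => j _; rewrite [RHS]mxE.
Qed.

Definition at_idx (w : 'cV[C]_#|T|) (t : T) : C := w (enum_rank t) 0.

Lemma at_idx_inj w w' : (forall t, at_idx w t = at_idx w' t) -> w = w'.
Proof. by move=> ww'; apply/colP => i; have := ww' (enum_val i); rewrite /at_idx enum_valK. Qed.

(** The indices that agree with [t] off slot [j] are the updates of [t] at [j]. In this form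
    identities between slot operators become manipulations of finite sums. *)
Lemma slot_opE j (A : 'M[C]_((ss j).+1)) w t :
  at_idx (slot_op A *m w) t = \sum_x A (t j) x * at_idx w (update t x).
Proof.
rewrite /at_idx mxE (reindex (@enum_rank T)) /=; last first.
  by apply: onW_bij; apply: enum_rank_bij.
under eq_bigr do rewrite mxE /tidx !enum_rankK (fun_if (fun z => z * _)) mul0r.
rewrite -big_mkcond /=.
rewrite (reindex_onto (fun x => update t x) (fun k : T => k j)) /=; last first.
  move=> k /forallP tk; apply/ffunP => l; have [<-|jl] := eqVneq j l.
    by rewrite update_same.
  by rewrite update_other //; apply/eqP; apply: (implyP (tk l)); rewrite eq_sym.
apply: eq_big => [x|x _]; last by rewrite update_same.
rewrite update_same eqxx andbT; apply/forallP => l; apply/implyP => lj.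
by rewrite update_other // eq_sym.
Qed.

Lemma slot_op_linear j c (A B : 'M[C]_((ss j).+1)) :
  slot_op (c *: A + B) = c *: slot_op A + slot_op B.
Proof. by apply/matrixP => i k; rewrite !mxE; case: ifP => // _; rewrite mulr0 addr0. Qed.

Lemma slot_op_mul j (A B : 'M[C]_((ss j).+1)) : slot_op A *m slot_op B = slot_op (A *m B).
Proof.
apply: mulmx_ext => w; apply: at_idx_inj => t; rewrite -mulmxA !slot_opE.
under eq_bigr do rewrite slot_opE update_same mulr_sumr.
rewrite exchange_big /=; apply: eq_bigr => y _; rewrite mxE mulr_suml.
by apply: eq_bigr => x _; rewrite update_update mulrA.
Qed.

Lemma slot_op_comm j l (A : 'M[C]_((ss j).+1)) (B : 'M[C]_((ss l).+1)) : j != l ->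
  slot_op A *m slot_op B = slot_op B *m slot_op A.
Proof.
move=> jl; apply: mulmx_ext => w; apply: at_idx_inj => t; rewrite -!mulmxA !slot_opE.
under eq_bigr do rewrite slot_opE update_other // mulr_sumr.
under [RHS]eq_bigr do rewrite slot_opE update_other 1?eq_sym // mulr_sumr.
rewrite exchange_big /=; apply: eq_bigr => y _; apply: eq_bigr => x _.
by rewrite (update_swap _ _ _ jl) mulrCA.
Qed.

Lemma slot_op_bracket j (A B : 'M[C]_((ss j).+1)) :
  slot_op (A *m B - B *m A) = slot_op A *m slot_op B - slot_op B *m slot_op A.
Proof. by rewrite !slot_op_mul addrC -scaleN1r slot_op_linear scaleN1r addrC. Qed.

(** Operators in different slots commute, so only the diagonal of the double sum remains. *)
Lemma slot_op_sum_bracket (A B : forall j, 'M[C]_((ss j).+1)) :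
  \sum_j slot_op (A j *m B j - B j *m A j) =
  (\sum_j slot_op (A j)) *m (\sum_j slot_op (B j))
  - (\sum_j slot_op (B j)) *m (\sum_j slot_op (A j)).
Proof.
rewrite mulmx_suml [X in _ = _ - X]mulmx_sumr -sumrB; apply: eq_bigr => j _.
rewrite mulmx_sumr mulmx_suml -sumrB (bigD1 j) //= big1 => [|l lj].
  by rewrite addr0 slot_op_bracket.
by rewrite slot_op_comm 1?eq_sym // subrr.
Qed.

Definition pure_tensor (u : forall j, 'cV[C]_((ss j).+1)) : 'cV[C]_#|T| :=
  \col_i \prod_j u j (tidx i j) 0.

Lemma pure_tensorE u t : at_idx (pure_tensor u) t = \prod_j u j (t j) 0.
Proof. by rewrite /at_idx mxE /tidx enum_rankK. Qed.

Lemma slot_op_eigen u j (A : 'M[C]_((ss j).+1)) c : A *m u j = c *: u j ->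
  slot_op A *m pure_tensor u = c *: pure_tensor u.
Proof.
move=> Au; apply: at_idx_inj => t.
rewrite slot_opE {2}/at_idx mxE -/(at_idx _ t) pure_tensorE (bigD1 j) //=.
rewrite mulrA; have /colP/(_ (t j)) := Au; rewrite [RHS]mxE => <-.
rewrite mxE mulr_suml; apply: eq_bigr => x _; rewrite pure_tensorE (bigD1 j) //=.
rewrite update_same mulrA; congr (_ * _); apply: eq_bigr => l lj.
by rewrite update_other // eq_sym.
Qed.

End TensorOperators.

(** * Evaluation tensor products *)

Section EvaluationTensors.
Variables (C : numClosedFieldType) (n : nat) (a : 'I_n -> C) (ss : 'I_n -> nat).
Implicit Types (p q r : {poly C}).
Local Notation N := #|TT ss|.

Lemma in_OA_value (X : C -> 'M[C]_2) b : in_OA X -> exists x y z, X b = sl2_mat x y z.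
Proof.
move=> /in_OA_triple [p [q [r ->]]]; have [->|b0] := eqVneq b 0.
  by exists 0, 0, 0; rewrite OA_triple0 /sl2_mat !scale0r !addr0.
by rewrite OA_tripleE //; do 3!eexists.
Qed.

Lemma slot_op_trace j (A B : 'M[C]_((ss j).+1)) : \tr (slot_op (A *m B - B *m A)) = 0.
Proof. by rewrite slot_op_bracket linearB /= mxtrace_mulC subrr. Qed.

Lemma rhoAS_rep : is_sl_rep (rhoAS a ss).
Proof.
split=> [c X Y _ _|X Y inX inY|X inX].
- rewrite !rhoASE scaler_sumr -big_split; apply: eq_bigr => j _.
  by rewrite spin_mat_linear slot_op_linear.
- rewrite !rhoASE -slot_op_sum_bracket; apply: eq_bigr => j _; congr slot_op.
  have [x [y [z ->]]] := in_OA_value (a j) inX.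
  have [x' [y' [z' ->]]] := in_OA_value (a j) inY.
  exact: spin_mat_bracket.
- rewrite rhoASE raddf_sum /= big1 // => j _.
  have [x [y [z ->]]] := in_OA_value (a j) inX.
  (* sl_2 is perfect and commutators have trace 0: [h, (x e - y f)/2] = x e + y f and [z e, f] = z
     h. *)
  have -> : sl2_mat x y z =
      1 *: (sl2_mat 0 0 1 *m sl2_mat (x / 2) (- y / 2) 0
            - sl2_mat (x / 2) (- y / 2) 0 *m sl2_mat 0 0 1)
      + (sl2_mat z 0 0 *m sl2_mat 0 1 0 - sl2_mat 0 1 0 *m sl2_mat z 0 0).
    by rewrite !sl2_mat_bracket sl2_mat_linear; congr sl2_mat; field.
  rewrite spin_mat_linear !spin_mat_bracket slot_op_linear mxtraceD mxtraceZ.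
  by rewrite !slot_op_trace mulr0 addr0.
Qed.

Definition rhoAS_module := module_of_rep rhoAS_rep.
Local Notation M := rhoAS_module.

Lemma TT_card_gt0 : (0 < N)%N.
Proof. by apply/card_gt0P; exists (finfun (fun=> ord0)). Qed.

(** This and the next two operators put the triple E', F', X behind [OA_triple] into slot [j]. *)
Definition raise_slot j :=
  slot_op (spin_mat (ss j) (sl2_mat 2^-1 (- 2^-1) (- 2^-1)) : 'M[C]_((ss j).+1)).
Definition lower_slot j :=
  slot_op (spin_mat (ss j) (sl2_mat (- 2^-1) 2^-1 (- 2^-1)) : 'M[C]_((ss j).+1)).
Definition weight_slot j :=
  slot_op (spin_mat (ss j) (sl2_mat 1 1 0) : 'M[C]_((ss j).+1)).

Lemma sl2_matZ (c x y z : C) : sl2_mat (c * x) (c * y) (c * z) = c *: sl2_mat x y z.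
Proof. by apply/matrixP => i j; rewrite !mxE; ring. Qed.

Lemma slot_spinZ j c (A : 'M[C]_2) :
  slot_op (spin_mat (ss j) (c *: A)) = c *: slot_op (spin_mat (ss j) A) :> 'M[C]_N.
Proof.
have slot0 : slot_op (0 : 'M[C]_((ss j).+1)) = 0.
  by have := slot_op_linear (-1) (0 : 'M[C]_((ss j).+1)) 0; rewrite scaler0 addr0 scaleN1r addNr.
have spin0 : spin_mat (ss j) (0 : 'M[C]_2) = 0.
  by have := spin_mat_linear (ss j) (-1) (0 : 'M[C]_2) 0; rewrite scaler0 addr0 scaleN1r addNr.
by rewrite -[c *: A]addr0 spin_mat_linear spin0 slot_op_linear slot0 addr0.
Qed.

Hypothesis a_neq0 : forall j, a j != 0.
Definition point j := a j + (a j)^-1.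
Definition gap j := a j - (a j)^-1.

Lemma rhoAS_opE p : opE M p = \sum_j (gap j * p.[point j]) *: raise_slot j.
Proof.
rewrite /= rhoASE; apply: eq_bigr => j _; rewrite -slot_spinZ; congr (slot_op (spin_mat _ _)).
rewrite OA_tripleE // -sl2_matZ; congr sl2_mat;
  rewrite /gap /point ?horner_simp ?horner0; by field; rewrite ?a_neq0.
Qed.

Lemma rhoAS_opF p : opF M p = \sum_j (gap j * p.[point j]) *: lower_slot j.
Proof.
rewrite /= rhoASE; apply: eq_bigr => j _; rewrite -slot_spinZ; congr (slot_op (spin_mat _ _)).
rewrite OA_tripleE // -sl2_matZ; congr sl2_mat;
  rewrite /gap /point ?horner_simp ?horner0; by field; rewrite ?a_neq0.
Qed.

Lemma rhoAS_opH p : opH M p = \sum_j p.[point j] *: weight_slot j.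
Proof.
rewrite /= rhoASE; apply: eq_bigr => j _; rewrite -slot_spinZ; congr (slot_op (spin_mat _ _)).
rewrite OA_tripleE // -sl2_matZ; congr sl2_mat;
  rewrite /gap /point ?horner_simp ?horner0; by field; rewrite ?a_neq0.
Qed.

Definition rhoAS_hw : 'cV[C]_N := pure_tensor (fun j => spin_hw C (ss j)).
Definition rhoAS_weight p := \sum_j (ss j)%:R * p.[point j].

Lemma rhoAS_highest_weight : highest_weight M rhoAS_hw rhoAS_weight.
Proof.
split=> [|p|p].
(* The coordinate at the zero index is a product of factors 1/0!. *)
- apply/eqP => w0; have := pure_tensorE (fun j => spin_hw C (ss j)) (finfun (fun=> ord0)).
  rewrite -/rhoAS_hw w0 /at_idx mxE => /esym/eqP; rewrite prodf_seq_eq0 => /hasP [j _].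
  by rewrite ffunE mxE fact0 invr1 oner_eq0.
- rewrite rhoAS_opE mulmx_suml big1 // => j _; rewrite -scalemxAl.
  rewrite (slot_op_eigen (c := 0)) ?scale0r ?scaler0 //.
  exact: spin_hw_raise.
- rewrite rhoAS_opH mulmx_suml scaler_suml; apply: eq_bigr => j _; rewrite -scalemxAl.
  by rewrite (slot_op_eigen (c := (ss j)%:R)) ?scalerA 1?mulrC //; exact: spin_hw_weight.
Qed.

Lemma rhoAS_nonzero : (0 < n)%N -> (forall j, (0 < ss j)%N) -> rep_nonzero (rhoAS a ss).
Proof.
move=> n0 ss0; exists (OA_triple 1 0 0); split; first exact: OA_triple_in.
apply/eqP => H0; have [v0 _ /(_ 1)] := rhoAS_highest_weight.
rewrite /= H0 mul0mx => /esym/eqP; rewrite scaler_eq0 (negPf v0) orbF /rhoAS_weight.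
under eq_bigr do rewrite hornerC mulr1.
rewrite -natr_sum pnatr_eq0 sum_nat_eq0 => /forallP /(_ (Ordinal n0)) /=.
by rewrite -leqn0 leqNgt ss0.
Qed.

Hypotheses (gap_neq0 : forall j, gap j != 0) (point_inj : injective point).
Hypothesis ss_gt0 : forall j, (0 < ss j)%N.

Definition interpolate j := lagrange (codom point) (point j).

Lemma interpolateE j k : (interpolate j).[point k] = (k == j)%:R.
Proof. by rewrite lagrangeE ?codom_f // (inj_eq point_inj). Qed.

Lemma interpolate_sum j (c : 'I_n -> C) (F : 'I_n -> 'M[C]_N) :
  \sum_k (c k * (interpolate j).[point k]) *: F k = c j *: F j.
Proof.
rewrite (bigD1 j) //= big1 => [|k kj]; rewrite interpolateE.
  by rewrite eqxx mulr1 addr0.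
by rewrite (negPf kj) mulr0 scale0r.
Qed.

(** At the polynomial [interpolate j], [opE] is [gap j] times [raise_slot j], and similarly for
    [opF] and [opH]. Together these generate all matrices in the slot. *)
Lemma rhoAS_slot_stable P : subspace P -> op_stable M P ->
  forall j (A : 'M[C]_((ss j).+1)) w, P w -> P (slot_op A *m w).
Proof.
move=> sP stP j A w Pw.
have PE w' : P w' -> P (raise_slot j *m w').
  move=> Pw'; have [+ _ _] := stP (interpolate j) _ Pw'.
  rewrite rhoAS_opE interpolate_sum => /(subspaceZ (gap j)^-1 sP).
  by rewrite -scalemxAl scalerA mulVf // scale1r.
have PF w' : P w' -> P (lower_slot j *m w').
  move=> Pw'; have [_ + _] := stP (interpolate j) _ Pw'.
  rewrite rhoAS_opF interpolate_sum => /(subspaceZ (gap j)^-1 sP).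
  by rewrite -scalemxAl scalerA mulVf // scale1r.
have PH w' : P w' -> P (weight_slot j *m w').
  move=> Pw'; have [_ _] := stP (interpolate j) _ Pw'.
  rewrite rhoAS_opH; under eq_bigr do rewrite -[_.[_]]mul1r.
  by rewrite interpolate_sum scale1r.
move: A w Pw; apply: (@spin_generate C (ss j) (fun A => forall w, P w -> P (slot_op A *m w))) => //.
(* Here e + f is X, and e - f is E' - F'. *)
- move=> w Pw; have -> : slot_op (spin_e C (ss j)) =
      2^-1 *: (weight_slot j + (raise_slot j - lower_slot j)).
    rewrite /weight_slot /raise_slot /lower_slot !spin_matE; apply/matrixP => i k.
    by rewrite !mxE; case: ifP => _; field.
  rewrite -scalemxAl mulmxDl mulmxBl; apply: subspaceZ => //.
  by apply: subspaceD => //; [exact: PH | apply: subspaceB => //; [exact: PE | exact: PF]].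
- move=> w Pw; have -> : slot_op (spin_f C (ss j)) =
      2^-1 *: (weight_slot j - (raise_slot j - lower_slot j)).
    rewrite /weight_slot /raise_slot /lower_slot !spin_matE; apply/matrixP => i k.
    by rewrite !mxE; case: ifP => _; field.
  rewrite -scalemxAl !mulmxBl; apply: subspaceZ => //.
  by apply: subspaceB => //; [exact: PH | apply: subspaceB => //; [exact: PE | exact: PF]].
- move=> c A B QA QB w Pw; rewrite slot_op_linear mulmxDl -scalemxAl; apply: sP.2.
    exact: QA.
  exact: QB.
- by move=> A B QA QB w Pw; rewrite -slot_op_mul -mulmxA; apply/QA/QB.
Qed.

Lemma rhoAS_op_irreducible : op_irreducible M.
Proof.
move=> P sP stP [w [Pw w0]].
have slotP := rhoAS_slot_stable sP stP.
have [t0 wt0] : exists t, at_idx w t != 0.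
  apply: contrapT => /forallNP nt; case/eqP: w0; apply: at_idx_inj => t.
  by rewrite [RHS]mxE; apply/eqP; apply: contrapT => /negP; apply: nt.
pose mix (r : seq 'I_n) (t : TT ss) : TT ss := finfun (fun l => if l \in r then t0 l else t l).
(* Matrix units at [(k j, t0 j)] are applied slot by slot. After the slots in [r], the vector is
   supported where [t] agrees with [k] on [r], and its value there is that of [w] with these slots
   reset to [t0]. With all slots treated, only a multiple of the basis vector at [k] is left. *)
have step k (r : seq 'I_n) : uniq r -> exists w', P w' /\
    forall t, at_idx w' t = if all (fun l => t l == k l) r then at_idx w (mix r t) else 0.
  elim: r => [_|j r IH /= /andP [jr ur]].
    exists w; split => // t /=; congr at_idx; apply/ffunP => l; by rewrite ffunE.
  have [w' [Pw' w'E]] := IH ur.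
  exists (slot_op (delta_mx (k j) (t0 j)) *m w'); split; first exact: slotP.
  move=> t; rewrite slot_opE (bigD1 (t0 j)) //= big1 => [|x xt]; last first.
    by rewrite mxE (negPf xt) andbF mul0r.
  rewrite mxE eqxx andbT addr0; case: eqP => [tj|_]; last by rewrite mul0r.
  rewrite mul1r w'E /=.
  have -> : all (fun l => update t (t0 j) l == k l) r = all (fun l => t l == k l) r.
    apply: eq_in_all => l lr; rewrite update_other //.
    by apply: contraNneq jr => ->.
  case: ifP => // _; congr at_idx; apply/ffunP => l; rewrite !ffunE inE.
  case: ifP => [_|lr]; first by rewrite orbT.
  rewrite orbF; have [->|jl] := eqVneq l j; first by rewrite dfwith_in.
  by rewrite dfwith_out // eq_sym.
have basis k : P (delta_mx (enum_rank k) 0).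
  have [w' [Pw' w'E]] := step k (enum 'I_n) (enum_uniq _).
  have -> : delta_mx (enum_rank k) 0 = (at_idx w t0)^-1 *: w'.
    have scaleE c t : at_idx (c *: w') t = c * at_idx w' t by rewrite /at_idx mxE.
    apply: at_idx_inj => t; rewrite scaleE w'E.
    rewrite {1}/at_idx mxE eqxx andbT (inj_eq enum_rank_inj).
    have -> : mix (enum 'I_n) t = t0 by apply/ffunP => l; rewrite ffunE mem_enum.
    have -> : all (fun l => t l == k l) (enum 'I_n) = (t == k).
      apply/allP/eqP => [tk|-> //]; apply/ffunP => l; apply/eqP/tk.
      by rewrite mem_enum.
    by case: (t == k); rewrite ?mulr0 // mulVf.
  exact: subspaceZ.
move=> u; rewrite -[u]mul1mx; apply: subspace_mulmx => // i.
by rewrite col1 -(enum_valK i); apply: basis.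
Qed.

Lemma rhoAS_irreducible : rep_irreducible (rhoAS a ss).
Proof.
apply/(module_of_rep_irreducible rhoAS_rep); split; first exact: TT_card_gt0.
exact: rhoAS_op_irreducible.
Qed.

End EvaluationTensors.

(** * Hermitian forms *)

Section HermitianForms.
Variables (C : numClosedFieldType) (n : nat) (a : 'I_n -> C) (ss : 'I_n -> nat).
Local Notation N := #|TT ss|.
Hypothesis a_neq0 : forall j, a j != 0.

(* [|v_k|^2] for the form on [V(d/2)] for which [e] and [f] are adjoint. *)
Definition spin_norm (d k : nat) : C := (k`! * d ^_ k)%:R.

Lemma spin_norm_gt0 d (k : 'I_d.+1) : 0 < spin_norm d k.
Proof. by rewrite ltr0n muln_gt0 fact_gt0 ffact_gt0 -ltnS ltn_ord. Qed.

(** [e] and [f] are adjoint for this form, and for [b] on the unit circle the coefficients of 2b e +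
    2b^-1 f are conjugate to each other. *)
Lemma spin_norm_adjoint d (b : C) (x y : 'I_d.+1) : b^* = b^-1 ->
  spin_norm d x * spin_mat d (sl2_mat (2 * b) (2 * b^-1) 0) x y =
  spin_norm d y * (spin_mat d (sl2_mat (2 * b) (2 * b^-1) 0) y x)^*.
Proof.
move=> bb; have bb' : (b^-1)^* = b by rewrite fmorphV /= bb invrK.
have two : (2 : C)^* = 2 by rewrite conjC_nat.
have succ k : (k < d.+1)%N -> spin_norm d k.+1 = spin_norm d k * (k.+1 * (d.+1 - k.+1))%:R.
  by move=> _; rewrite /spin_norm -natrM subSS factS ffactnSr; congr (_%:R); ring.
rewrite spin_matE !mxE !rmorphD !rmorphM /= bb bb' two conjC0 !mul0r !addr0.
case: (eqVneq (y : nat) x.+1) => [yx|nyx]; case: (eqVneq (x : nat) y.+1) => [xy|nxy].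
- by move: (ltnn x); rewrite {2}xy yx ltnS leqnSn.
- by rewrite ?rmorphM /= ?conjC_nat ?conjC0 ?conjC1 yx succ // natrM; ring.
- by rewrite ?rmorphM /= ?conjC_nat ?conjC0 ?conjC1 xy succ // natrM; ring.
- by rewrite !conjC0 !mulr0 !addr0 !mulr0.
Qed.

Definition tensor_norm (i : 'I_N) : C := \prod_j spin_norm (ss j) (tidx i j).

Lemma slot_norm_adjoint j (A : 'M[C]_((ss j).+1)) (i k : 'I_N) :
  (forall x y : 'I_(ss j).+1, spin_norm (ss j) x * A x y = spin_norm (ss j) y * (A y x)^*) ->
  tensor_norm i * slot_op A i k = tensor_norm k * (slot_op A k i)^*.
Proof.
move=> AA; rewrite !mxE.
have -> : [forall l, (l != j) ==> (tidx k l == tidx i l)]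
      = [forall l, (l != j) ==> (tidx i l == tidx k l)].
  by apply: eq_forallb => l; congr (_ ==> _); rewrite eq_sym.
case: ifP => [/forallP ik|_]; last by rewrite conjC0 !mulr0.
rewrite /tensor_norm (bigD1 j) //= [in RHS](bigD1 j) //= mulrAC AA mulrAC.
congr (_ * _ * _); apply: eq_bigr => l lj.
by have /implyP/(_ lj)/eqP -> := ik l.
Qed.

Definition tensor_form (u w : 'cV[C]_N) : C := \sum_i tensor_norm i * u i 0 * (w i 0)^*.

Lemma tensor_form_adjoint (A : 'M[C]_N) :
  (forall i k, tensor_norm i * A i k = tensor_norm k * (A k i)^*) ->
  forall u w, tensor_form (A *m u) w = tensor_form u (A *m w).
Proof.
move=> AA u w; rewrite /tensor_form.
under eq_bigr do rewrite mxE mulr_sumr mulr_suml.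
under [RHS]eq_bigr do rewrite mxE rmorph_sum mulr_sumr.
rewrite exchange_big; apply: eq_bigr => k _; apply: eq_bigr => i _ /=.
by rewrite rmorphM mulrA AA /= [RHS]mulrA (mulrAC (tensor_norm k)).
Qed.

Lemma tensor_norm_gt0 i : 0 < tensor_norm i.
Proof. by apply: prodr_gt0 => j _; apply: spin_norm_gt0. Qed.

Lemma rhoAS_hermitian : (forall j, (a j)^* = (a j)^-1) -> rep_hermitian (rhoAS a ss).
Proof.
move=> aa.
have Am m u w : tensor_form (rhoAS a ss (@OA_A C m) *m u) w
    = tensor_form u (rhoAS a ss (@OA_A C m) *m w).
  apply: tensor_form_adjoint => i k; rewrite rhoASE !summxE rmorph_sum !mulr_sumr.
  apply: eq_bigr => j _; apply: slot_norm_adjoint => x y.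
  have -> : @OA_A C m (a j) = sl2_mat (2 * (a j) ^ m) (2 * ((a j) ^ m)^-1) 0.
    by rewrite /OA_A /OAelt (negPf (a_neq0 j)) exprz_inv invr_expz.
  apply: spin_norm_adjoint; rewrite invr_expz -exprz_inv -aa.
  by case: (m) => N'; rewrite /exprz ?fmorphV /= rmorphXn /= aa.
exists tensor_form; split => //.
- move=> c u v w; rewrite /tensor_form mulr_sumr -big_split; apply: eq_bigr => i _.
  by rewrite !mxE /=; ring.
- move=> u w; rewrite /tensor_form rmorph_sum; apply: eq_bigr => i _.
  rewrite !rmorphM /= conjCK (conj_Creal (gtr0_real (tensor_norm_gt0 i))); ring.
- move=> u u0; rewrite /tensor_form.
  have pos i : 0 <= tensor_norm i * u i 0 * (u i 0)^*.
    by rewrite -mulrA mulr_ge0 ?mul_conjC_ge0 // ltW // tensor_norm_gt0.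
  rewrite lt0r sumr_ge0 // andbT psumr_eq0 //; apply: contra u0 => /allP u0.
  apply/eqP/colP => i; rewrite [RHS]mxE; have := u0 i (mem_index_enum i).
  rewrite /= -mulrA mulf_eq0 (gt_eqF (tensor_norm_gt0 i)) /= mul_conjC_eq0.
  by move/eqP.
Qed.

End HermitianForms.

(** * Adjoints of the triangular operators *)

Section HermitianModules.
Variables (C : numClosedFieldType) (m : nat) (ip : 'cV[C]_m -> 'cV[C]_m -> C).
Hypothesis ip_linear : forall c u v w, ip (c *: u + v) w = c * ip u w + ip v w.
Hypothesis ip_sym : forall u w, ip w u = (ip u w)^*.

Lemma ip0l w : ip 0 w = 0.
Proof. by have := ip_linear (-1) 0 0 w; rewrite scaler0 addr0 mulN1r addNr. Qed.

Lemma ipZl c u w : ip (c *: u) w = c * ip u w.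
Proof. by rewrite -[_ *: _]addr0 ip_linear ip0l addr0. Qed.

Lemma ipZr c u w : ip u (c *: w) = c^* * ip u w.
Proof. by rewrite ip_sym ipZl rmorphM /= -ip_sym. Qed.

Lemma ip_linearr c u v w : ip u (c *: v + w) = c^* * ip u v + ip u w.
Proof. by rewrite ip_sym ip_linear rmorphD rmorphM /= -!ip_sym. Qed.

Lemma ip_suml I (r : seq I) (F : I -> 'cV[C]_m) w :
  ip (\sum_(i <- r) F i) w = \sum_(i <- r) ip (F i) w.
Proof.
elim: r => [|i r IH]; rewrite ?big_nil ?ip0l // !big_cons.
by rewrite -IH -[F i]scale1r ip_linear scale1r mul1r.
Qed.

Definition adjoint_ops (A B : 'M[C]_m) := forall u w, ip (A *m u) w = ip u (B *m w).

Lemma adjoint_linear c A B A' B' : adjoint_ops A B -> adjoint_ops A' B' ->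
  adjoint_ops (c *: A + A') (c^* *: B + B').
Proof.
move=> AB AB' u w; rewrite !mulmxDl -!scalemxAl ip_linear ip_linearr conjCK.
by rewrite AB AB'.
Qed.

Lemma adjoint_mul A B A' B' : adjoint_ops A B -> adjoint_ops A' B' ->
  adjoint_ops (A *m A') (B' *m B).
Proof. by move=> AB AB' u w; rewrite -!mulmxA AB AB'. Qed.

Lemma adjointB A B A' B' : adjoint_ops A B -> adjoint_ops A' B' ->
  adjoint_ops (A - A') (B - B').
Proof.
move=> AB AB'; rewrite ![_ - _]addrC -!scaleN1r.
by have := adjoint_linear (-1) AB' AB; rewrite rmorphN /= conjC1.
Qed.

(* [ad (H 1)] separates the three summands of [H 'X + E 1 - F 1], which are
   eigenvectors for 0, 2 and -2. *)
Lemma hermitian_adjoints (M : onsager_module C m) :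
  adjoint_ops (opH M 1) (opH M 1) ->
  adjoint_ops (opH M 'X + opE M 1 - opF M 1) (opH M 'X + opE M 1 - opF M 1) ->
  adjoint_ops (opE M 1) (- opF M 1) /\ adjoint_ops (opH M 'X) (opH M 'X).
Proof.
set H := opH M 1; set S := _ - opF M 1 => aH aS.
have HE : H *m opE M 1 = opE M 1 *m H + 2 *: opE M 1 by rewrite opHE mulr1.
have HF : H *m opF M 1 = opF M 1 *m H - 2 *: opF M 1 by rewrite opHF mulr1.
have D1 : H *m S - S *m H = 2 *: (opE M 1 + opF M 1).
  rewrite /S mulmxBr mulmxDr mulmxBl mulmxDl HE HF (opHH M 1 'X) -/H.
  by apply/matrixP => i j; rewrite !mxE; ring.
have D2 : H *m (H *m S - S *m H) - (H *m S - S *m H) *m H = 4 *: (opE M 1 - opF M 1).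
  rewrite D1 -scalemxAr -scalemxAl mulmxDr mulmxDl HE HF.
  by apply/matrixP => i j; rewrite !mxE; ring.
have a1 : adjoint_ops (H *m S - S *m H) (S *m H - H *m S).
  by apply: adjointB; apply: adjoint_mul.
have a2 : adjoint_ops (4 *: (opE M 1 - opF M 1)) (4 *: (opE M 1 - opF M 1)).
  rewrite -{1}D2 -[X in adjoint_ops _ X](_ : (S *m H - H *m S) *m H - H *m (S *m H - H *m S) = _).
    by apply: adjointB; apply: adjoint_mul.
  by rewrite -D2 -(opprB (H *m S)) mulNmx mulmxN opprK addrC.
have four : (8^-1 : C)^* = 8^-1 by rewrite fmorphV /= conjC_nat.
have quart : (4^-1 : C)^* = 4^-1 by rewrite fmorphV /= conjC_nat.
have mquart : (- 4^-1 : C)^* = - 4^-1 by rewrite rmorphN /= quart.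
rewrite -[S *m H - _]opprB D1 in a1; split.
  have a0 : adjoint_ops 0 0 by move=> u w; rewrite !mul0mx (ip_sym 0 u) !ip0l conjC0.
  (* E = 2(E+F)/4 + 4(E-F)/8, where taking adjoints negates the first term and fixes the second; the
     result is -F. *)
  have := adjoint_linear 4^-1 a1 (adjoint_linear 8^-1 a2 a0); rewrite four quart.
  set A := (X in adjoint_ops X _); set B := (X in adjoint_ops _ X).
  have -> : A = opE M 1 by apply/matrixP => i j; rewrite !mxE; field.
  by have -> : B = - opF M 1 by apply/matrixP => i j; rewrite !mxE; field.
have := adjoint_linear (- 4^-1) a2 aS; rewrite mquart.
have -> // : - 4^-1 *: (4 *: (opE M 1 - opF M 1)) + S = opH M 'X.
by apply/matrixP => i j; rewrite /S !mxE; field.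
Qed.

End HermitianModules.

(** * Location of the evaluation points in the Hermitian case *)

Section HermitianPoints.
Variable C : numClosedFieldType.

Lemma OA_A0E : OA_A 0 = OA_triple (2%:P : {poly C}) 0 0.
Proof.
apply: funext => a; have [->|a0] := eqVneq a 0.
  by rewrite OA_triple0 /OA_A /OAelt eqxx.
rewrite OA_tripleE // /OA_A /OAelt (negPf a0) !expr0z.
by congr sl2_mat; rewrite ?horner_simp ?horner0; ring.
Qed.

Lemma OA_A1E : OA_A 1 = OA_triple ('X : {poly C}) 1 (-1).
Proof.
apply: funext => a; have [->|a0] := eqVneq a 0.
  by rewrite OA_triple0 /OA_A /OAelt eqxx.
rewrite OA_tripleE // /OA_A /OAelt (negPf a0) !expr1z.
by congr sl2_mat; rewrite ?horner_simp; field.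
Qed.

Lemma pointE n (a : 'I_n -> C) j : point a j = 2 * ahat (a j).
Proof. by rewrite /point /ahat mulrC divfK // pnatr_eq0. Qed.

Lemma gap_sqr n (a : 'I_n -> C) j : a j != 0 -> gap a j ^+ 2 = point a j ^+ 2 - 4.
Proof. by move=> a0; rewrite /gap /point; field. Qed.

(** Only F_1 has a known adjoint, not the interpolating F_{l_j}. But F_1 v is the sum of the u_j =
    F_{l_j} v, and these are orthogonal as eigenvectors of the self-adjoint H_x with distinct
    eigenvalues. Pairing E_1 u_j with v thus gives [ss j] (x_j^2 - 4) |v|^2 = -|u_j|^2 < 0. *)
Lemma rhoAS_hermitian_points n (a : 'I_n -> C) (ss : 'I_n -> nat) :
  (forall j, a j != 0) -> (forall j, gap a j != 0) -> injective (point a) ->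
  (forall j, (0 < ss j)%N) -> rep_hermitian (rhoAS a ss) ->
  forall j, -1 < ahat (a j) < 1.
Proof.
move=> a0 g0 pinj ss0 [ip [lin sym pos h0 h1]].
pose M := rhoAS_module a ss; pose v := rhoAS_hw C ss; pose lam := rhoAS_weight a ss.
have hwv : highest_weight M v lam := rhoAS_highest_weight ss a0.
have [v0 Ev Hv] := hwv.
have [||aE aX] := @hermitian_adjoints _ _ ip lin sym M.
- have aH : adjoint_ops ip (opH M 2%:P) (opH M 2%:P) by move=> u w; rewrite /= -OA_A0E.
  have -> : opH M 1 = 2^-1 *: opH M 2%:P + 0.
    have H0 : opH M 0 = 0 by have := opH_linear M (-1) 0 0; rewrite scaler0 addr0 scaleN1r addNr.
    by rewrite -H0 -opH_linear addr0 -mul_polyC -polyCM mulVf // pnatr_eq0.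
  have z0 : adjoint_ops ip 0 0 by move=> u w; rewrite !mul0mx (sym 0 u) !(ip0l lin) conjC0.
  by have := adjoint_linear lin sym 2^-1 aH z0; rewrite fmorphV /= conjC_nat.
- have -> : opH M 'X + opE M 1 - opF M 1 = rhoAS a ss (OA_A 1).
    rewrite OA_A1E (rho_tripleE (rhoAS_rep a ss)); congr (_ + _).
    have := rho_tripleZ (rhoAS_rep a ss) (-1) 0 0 1.
    by rewrite !scaler0 !scaleN1r => ->.
  exact: h1.
pose l j := interpolate a j; pose u j := opF M (l j) *m v.
have lE j k : (l j).[point a k] = (k == j)%:R by apply: interpolateE.
have uE j : opE M 1 *m u j = ((ss j)%:R * (point a j ^+ 2 - 4)) *: v.
  rewrite /u (raising_lowering _ _ hwv); congr (_ *: _).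
  rewrite /lam /rhoAS_weight (bigD1 j) //= big1 => [|k kj].
    by rewrite addr0 !hornerM lE eqxx !mulr1 hornerC mulr1 /disc !horner_simp.
  by rewrite !horner_simp lE (negPf kj) !mulr0.
have u0 j : u j != 0.
  apply: contraNneq v0 => uj0; move: (uE j); rewrite uj0 mulmx0 => /esym/eqP.
  rewrite scaler_eq0 mulf_eq0 pnatr_eq0 -leqn0 leqNgt ss0 -gap_sqr //.
  by rewrite expf_eq0 (negPf (g0 j)) andbF.
have uX j : opH M 'X *m u j = (lam 'X - 2 * point a j) *: u j.
  have FX : opF M ('X * l j) = point a j *: opF M (l j).
    rewrite !rhoAS_opF // scaler_sumr; apply: eq_bigr => k _; rewrite scalerA !horner_simp lE.
    by have [->|_] := eqVneq k j; congr (_ *: _); rewrite ?mulr1 ?mulr0 /=; ring.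
  exact: lowering_weight hwv FX.
have F1 : opF M 1 *m v = \sum_j u j.
  rewrite rhoAS_opF // mulmx_suml; apply: eq_bigr => j _.
  by rewrite /u rhoAS_opF // interpolate_sum // hornerC mulr1.
have ipv_neq0 w : w != 0 -> ip w w != 0 by move=> /pos; rewrite lt0r => /andP [].
have real_eigen (w : 'cV[C]_#|TT ss|) c : w != 0 -> opH M 'X *m w = c *: w -> c \is Num.real.
  move=> w0 wc; apply/CrealP; have := aX w w; rewrite wc (ipZl lin) (ipZr lin sym).
  by move=> /(mulIf (ipv_neq0 w w0)) /esym.
(* The point is half the difference of two eigenvalues of H_x. *)
have preal j : point a j \is Num.real.
  have r1 := real_eigen v _ v0 (Hv 'X); have r2 := real_eigen _ _ (u0 j) (uX j).
  have -> : point a j = (lam 'X - (lam 'X - 2 * point a j)) / 2 by field.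
  by apply: rpredM; [exact: rpredB | rewrite rpredV realn].
have orth j k : k != j -> ip (u k) (u j) = 0.
  move=> kj; have := aX (u k) (u j); rewrite !uX (ipZl lin) (ipZr lin sym).
  have -> : (lam 'X - 2 * point a j)^* = lam 'X - 2 * point a j.
    by apply/CrealP; apply: (real_eigen (u j)).
  move=> /eqP; rewrite -subr_eq0 -mulrBl mulf_eq0 => /orP [|/eqP //].
  have -> : lam 'X - 2 * point a k - (lam 'X - 2 * point a j) = 2 * (point a j - point a k) by ring.
  by rewrite mulf_eq0 pnatr_eq0 subr_eq0 (inj_eq pinj) (eq_sym j) (negPf kj).
move=> j; have neg : point a j ^+ 2 < 4.
  have ssj : 0 < (ss j)%:R :> C by rewrite ltr0n.
  have e : (ss j)%:R * (point a j ^+ 2 - 4) * ip v v = - ip (u j) (u j).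
    have := aE (u j) v; rewrite uE (ipZl lin) => ->.
    rewrite mulNmx -scaleN1r (ipZr lin sym) rmorphN /= conjC1 F1 sym (ip_suml lin).
    rewrite (bigD1 j) //= big1 => [|k /orth //].
    by rewrite addr0 -sym mulN1r.
  have : (ss j)%:R * (point a j ^+ 2 - 4) * ip v v < 0 by rewrite e oppr_lt0 pos.
  by rewrite pmulr_llt0 ?pos // pmulr_rlt0 // subr_lt0.
have hreal : ahat (a j) \is Num.real.
  have -> : ahat (a j) = point a j / 2 by rewrite pointE mulrC mulKf // pnatr_eq0.
  by apply: rpredM; rewrite // rpredV realn.
rewrite -real_ltr_norml // -(@expr_lt1 _ 2) // real_normK //.
move: neg; rewrite pointE exprMn -[X in _ < X]mulr1 -natrX ltr_pM2l //.
Qed.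

Lemma ahat_unit (a : C) : a != 0 -> -1 < ahat a < 1 -> a^* = a^-1 /\ a - a^-1 != 0.
Proof.
move=> a0 /andP [h1 h2].
have hreal : ahat a \is Num.real by rewrite (ler_real (ltW h2)) real1.
have neg : (a - a^-1) ^+ 2 < 0.
  have -> : (a - a^-1) ^+ 2 = - (4 * ((1 - ahat a) * (1 + ahat a))) by rewrite /ahat; field.
  rewrite oppr_lt0 mulr_gt0 ?ltr0n // mulr_gt0 ?subr_gt0 //.
  by rewrite -[ahat a]opprK subr_gt0 ltrNl.
have g0 : a - a^-1 != 0 by apply: contraTneq neg => ->; rewrite expr0n /= ltxx.
split => //; have b0 : a^* != 0 by rewrite conjC_eq0.
have : (a^* - a) * (1 - (a * a^*)^-1) == 0.
  have e : ahat a^* = ahat a.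
    by rewrite -[RHS](conj_Creal hreal) /ahat !rmorphM rmorphD !fmorphV /= conjC_nat.
  have -> : (a^* - a) * (1 - (a * a^*)^-1) = 2 * (ahat a^* - ahat a).
    by rewrite /ahat; field; rewrite a0 b0.
  by rewrite e subrr mulr0.
rewrite mulf_eq0 => /orP [|].
  rewrite subr_eq0 => /eqP/CrealP ar; move: neg.
  have gr : a - a^-1 \is Num.real by rewrite rpredB // rpredV.
  by rewrite real_exprn_even_lt0 // ltNge.
rewrite subr_eq0 eq_sym invr_eq1 => /eqP aa.
by rewrite -[a^-1]mulr1 -aa mulKf.
Qed.

End HermitianPoints.

(** * Classification *)

Section Classification.
Variable C : numClosedFieldType.

Lemma point_root (c : C) : exists a : C, a != 0 /\ a + a^-1 = c.
Proof.
pose s := sqrtC (c ^+ 2 - 4); have s2 : s ^+ 2 = c ^+ 2 - 4 by apply: sqrtCK.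
(* The two factors are the roots of z^2 - c z + 1, hence inverse to each other. *)
have e : (c + s) / 2 * ((c - s) / 2) = 1.
  have -> : (c + s) / 2 * ((c - s) / 2) = (c ^+ 2 - s ^+ 2) / 4 by field.
  by rewrite s2; field.
have a0 : (c + s) / 2 != 0.
  by apply: contraTneq (oner_neq0 C) => a0; rewrite -e a0 mul0r eqxx.
exists ((c + s) / 2); split => //.
by have -> : ((c + s) / 2)^-1 = (c - s) / 2; [apply: (mulfI a0); rewrite divff // e | field].
Qed.

Lemma gap_eq0 (a : C) : a != 0 -> (a - a^-1 == 0) = (a + a^-1 == 2) || (a + a^-1 == - 2).
Proof.
move=> a0; rewrite -[a + _ == 2]subr_eq0 -[a + _ == - 2]subr_eq0 -mulf_eq0.
have -> : (a + a^-1 - 2) * (a + a^-1 - - 2) = (a - a^-1) ^+ 2 by field.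
by rewrite expf_eq0.
Qed.

Lemma rhoAS_rep_equiv m (rho : OA_rep C m) n (a : 'I_n -> C) (ss : 'I_n -> nat)
    (repr : is_sl_rep rho) v :
  (forall j, a j != 0) -> (forall j, gap a j != 0) -> injective (point a) ->
  (forall j, (0 < ss j)%N) -> rep_irreducible rho ->
  highest_weight (module_of_rep repr) v (rhoAS_weight a ss) ->
  rep_equiv rho (rhoAS a ss).
Proof.
move=> a0 g0 pinj ss0 /(module_of_rep_irreducible repr) [m0 irr] hw.
have [P [Q [PQ QP iP]]] := highest_weight_iso m0 (TT_card_gt0 ss) irr
  (rhoAS_op_irreducible a0 g0 pinj ss0) hw (rhoAS_highest_weight ss a0).
exists P, Q; split => //; exact/(module_intertwines repr (rhoAS_rep a ss)).
Qed.

Lemma irreducible_classification m (rho : OA_rep C m) :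
  is_sl_rep rho -> rep_irreducible rho -> rep_nonzero rho ->
  exists (n : nat) (a : 'I_n -> C) (ss : 'I_n -> nat),
    [/\ (0 < n)%N, (forall j, a j != 0 /\ gap a j != 0), injective (point a),
        (forall j, (0 < ss j)%N) & rep_equiv rho (rhoAS a ss)].
Proof.
move=> repr irr nz; have [m0 oirr] := (module_of_rep_irreducible repr).1 irr.
have [v [lam hw]] := highest_weight_exists (module_of_rep repr) m0.
have [s [k [us s2 sN2 lamE]]] := weight_shape m0 oirr hw (module_of_rep_trace repr).
(* Points of multiplicity 0 would give trivial slots, with spin 0. *)
pose s' := [seq c <- s | (0 < k c)%N].
have [root rootP] := choice point_root.
pose a (j : 'I_(size s')) := root s'`_j; pose ss (j : 'I_(size s')) := k s'`_j.
have s'j (j : 'I_(size s')) : s'`_j \in s' by apply: mem_nth.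
have pE j : point a j = s'`_j by rewrite /point (rootP _).2.
have a0 j : a j != 0 by rewrite (rootP _).1.
have g0 j : gap a j != 0.
  have := s'j j; rewrite mem_filter -pE => /andP [_ js].
  rewrite /gap gap_eq0 // negb_or; apply/andP; split.
    by apply: contraNneq s2 => <-.
  by apply: contraNneq sN2 => <-.
have pinj : injective (point a).
  move=> i j; rewrite !pE => /eqP; rewrite nth_uniq ?filter_uniq // => /eqP ij.
  exact: val_inj.
have ss0 j : (0 < ss j)%N by have := s'j j; rewrite mem_filter => /andP [].
have eqv : rep_equiv rho (rhoAS a ss).
  apply: (rhoAS_rep_equiv (repr := repr) (v := v)) => //.
  have [v0 Ev Hv] := hw; split => // p; rewrite Hv lamE; congr (_ *: _).
  rewrite /rhoAS_weight (bigID (fun c => (0 < k c)%N)) /= [X in _ + X]big1 ?addr0.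
    rewrite -big_filter -/s' (big_nth 0) big_mkord.
    by apply: eq_bigr => j _; rewrite pE.
  by move=> c; rewrite -leqNgt leqn0 => /eqP ->; rewrite mul0r.
(* With no slots the action would be zero, against [nz]. *)
exists (size s'), a, ss; split => //; rewrite lt0n; apply/eqP => n0.
have [X [inX /eqP]] := nz; apply; have [P [Q [PQ QP PX]]] := eqv.
have : rhoAS a ss X = 0.
  rewrite rhoASE big1 // => j _.
  by have s0 := leq_ltn_trans (leq0n j) (ltn_ord j); rewrite n0 in s0.
move=> X0; rewrite -[rho X]mulmx1 -PQ mulmxA (PX X inX) X0.
by rewrite mulmx0 mul0mx.
Qed.

Lemma hermitian_transport m n (rho : OA_rep C m) (rho' : OA_rep C n) :
  rep_equiv rho rho' -> rep_hermitian rho -> rep_hermitian rho'.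
Proof.
move=> [P [Q [PQ QP PX]]] [ip [lin sym pos h0 h1]].
have P0 : rho (OA_A 0) *m P = P *m rho' (OA_A 0).
  by apply: PX; rewrite OA_A0E; apply: OA_triple_in.
have P1 : rho (OA_A 1) *m P = P *m rho' (OA_A 1).
  by apply: PX; rewrite OA_A1E; apply: OA_triple_in.
exists (fun u w => ip (P *m u) (P *m w)); split.
- by move=> c u v w; rewrite mulmxDr -scalemxAr lin.
- by move=> u w; apply: sym.
- move=> u u0; apply: pos; apply: contraNneq u0 => Pu.
  by rewrite -[u]mul1mx -QP -mulmxA Pu mulmx0.
- by move=> u w; rewrite !mulmxA -P0 -!mulmxA h0.
- by move=> u w; rewrite !mulmxA -P1 -!mulmxA h1.
Qed.

(** Test the identity on the Lagrange polynomial of all points of both families at [x' j']. The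
    right side is [k' j'], which is positive, so [x' j'] must occur among the [x j], and the left
    side is then [k j]. *)
Lemma equal_weights_match n (x : 'I_n -> C) (k : 'I_n -> nat)
    n' (x' : 'I_n' -> C) (k' : 'I_n' -> nat) :
  injective x -> injective x' -> (forall j, (0 < k' j)%N) ->
  (forall p : {poly C}, \sum_j (k j)%:R * p.[x j] = \sum_j (k' j)%:R * p.[x' j]) ->
  forall j', exists j, x' j' = x j /\ k' j' = k j.
Proof.
move=> xinj xinj' k'0 eqw j'; pose s := codom x ++ codom x'.
have := eqw (lagrange s (x' j')).
rewrite [RHS](bigD1 j') //= [X in _ + X]big1 => [|i ij]; last first.
  by rewrite lagrangeE ?mem_cat ?codom_f ?orbT // (inj_eq xinj') (negPf ij) mulr0.
rewrite lagrangeE ?mem_cat ?codom_f ?orbT // eqxx mulr1 addr0 => e.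
have [/codomP [j xj]|nx] := boolP (x' j' \in codom x); last first.
  move: e; rewrite big1 => [/esym/eqP|i _].
    by rewrite pnatr_eq0 -leqn0 leqNgt k'0.
  rewrite lagrangeE ?mem_cat ?codom_f //; case: eqP => [xi|]; last by rewrite mulr0.
  by case/negP: nx; rewrite -xi codom_f.
exists j; split => //; move: e.
rewrite (bigD1 j) //= big1 => [|i ij].
  rewrite lagrangeE ?mem_cat ?codom_f // xj eqxx mulr1 addr0 => /eqP.
  by rewrite eqr_nat => /eqP.
by rewrite lagrangeE ?mem_cat ?codom_f // xj (inj_eq xinj) (negPf ij) mulr0.
Qed.

(** An intertwiner carries a highest weight vector to one of the same weight, and that weight is
    unique. *)
Lemma rep_equiv_weights n (a : 'I_n -> C) (ss : 'I_n -> nat)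
    n' (a' : 'I_n' -> C) (ss' : 'I_n' -> nat) :
  (forall j, a j != 0) -> (forall j, gap a j != 0) -> injective (point a) ->
  (forall j, (0 < ss j)%N) -> (forall j, a' j != 0) ->
  rep_equiv (rhoAS a ss) (rhoAS a' ss') ->
  forall p, rhoAS_weight a ss p = rhoAS_weight a' ss' p.
Proof.
move=> a0 g0 pinj ss0 a'0 [P [Q [PQ QP PX]]] p.
have iP := (module_intertwines (rhoAS_rep a ss) (rhoAS_rep a' ss') P).2 PX.
have [v0 Ev Hv] := rhoAS_highest_weight ss' a'0.
apply/esym; apply: (highest_weight_unique (TT_card_gt0 ss) (rhoAS_op_irreducible a0 g0 pinj ss0)
  (rhoAS_highest_weight ss a0) (v' := P *m rhoAS_hw C ss')).
split=> [|q|q].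
- apply: contraNneq v0 => Pv; by rewrite -[rhoAS_hw C ss']mul1mx -QP -mulmxA Pv mulmx0.
- by have [e _ _] := iP q; rewrite mulmxA e -mulmxA Ev mulmx0.
- by have [_ _ e] := iP q; rewrite mulmxA e -mulmxA Hv -scalemxAr.
Qed.

End Classification.

Section UnitCirclePoints.
Variables (C : numClosedFieldType) (n : nat) (a : 'I_n -> C).
Hypothesis a_unit : forall j, a j != 0 /\ -1 < ahat (a j) < 1.
Hypothesis ahat_neq : forall j k, j != k -> ahat (a j) != ahat (a k).

Lemma ahat_point_inj : injective (point a).
Proof.
move=> j k; rewrite !pointE => /mulfI jk; apply/eqP; apply: contraT => /ahat_neq.
by rewrite jk ?eqxx // pnatr_eq0.
Qed.

Lemma unit_neq0 j : a j != 0. Proof. by have [] := a_unit j. Qed.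

Lemma unit_gap j : gap a j != 0.
Proof. by have [a0 /(ahat_unit a0) []] := a_unit j. Qed.

Lemma unit_conj j : (a j)^* = (a j)^-1.
Proof. by have [a0 /(ahat_unit a0) []] := a_unit j. Qed.

End UnitCirclePoints.

Theorem theorem6 (R : realType) :
  (* classification of irreducible representations OA -> sl(V) *)
  (forall (m : nat) (rho : OA_rep R[i] m),
     is_sl_rep rho -> rep_irreducible rho -> rep_nonzero rho ->
     exists (n : nat) (a : 'I_n -> R[i]) (ss : 'I_n -> nat),
       [/\ (0 < n)%N,
           (forall j, [/\ a j != 0, a j != 1 & a j != -1]),
           (forall j k, j != k -> a j != a k /\ a j != (a k)^-1),
           (forall j, (0 < ss j)%N)
         & rep_equiv rho (rhoAS a ss)])
  /\
  (* irreducible Hermitian representations are equivalent to some rho_(a,s)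
     with the \hat a_j pairwise distinct in (-1,1) *)
  (forall (m : nat) (rho : OA_rep R[i] m),
     is_sl_rep rho -> rep_irreducible rho -> rep_nonzero rho -> rep_hermitian rho ->
     exists (n : nat) (a : 'I_n -> R[i]) (ss : 'I_n -> nat),
       [/\ (0 < n)%N,
           (forall j, a j != 0 /\ -1 < ahat (a j) < 1),
           (forall j k, j != k -> ahat (a j) != ahat (a k)),
           (forall j, (0 < ss j)%N)
         & rep_equiv rho (rhoAS a ss)])
  /\
  (* and every such rho_(a,s) is an irreducible Hermitian representation *)
  (forall (n : nat) (a : 'I_n -> R[i]) (ss : 'I_n -> nat),
     (0 < n)%N ->
     (forall j, a j != 0 /\ -1 < ahat (a j) < 1) ->
     (forall j k, j != k -> ahat (a j) != ahat (a k)) ->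
     (forall j, (0 < ss j)%N) ->
     [/\ is_sl_rep (rhoAS a ss), rep_irreducible (rhoAS a ss),
         rep_nonzero (rhoAS a ss) & rep_hermitian (rhoAS a ss)])
  /\
  (* equivalence criterion *)
  (forall (n : nat) (a : 'I_n -> R[i]) (ss : 'I_n -> nat)
          (n' : nat) (a' : 'I_n' -> R[i]) (ss' : 'I_n' -> nat),
     (0 < n)%N ->
     (forall j, a j != 0 /\ -1 < ahat (a j) < 1) ->
     (forall j k, j != k -> ahat (a j) != ahat (a k)) ->
     (forall j, (0 < ss j)%N) ->
     (0 < n')%N ->
     (forall j, a' j != 0 /\ -1 < ahat (a' j) < 1) ->
     (forall j k, j != k -> ahat (a' j) != ahat (a' k)) ->
     (forall j, (0 < ss' j)%N) ->
     (rep_equiv (rhoAS a ss) (rhoAS a' ss') <->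
      n = n' /\
      exists sigma : 'I_n' -> 'I_n,
        bijective sigma /\
        forall j, ahat (a' j) = ahat (a (sigma j)) /\ ss' j = ss (sigma j))).
Proof.
split; [|split; [|split]].
- move=> m rho repr irr nz.
  have [n [a [ss [n0 ag pinj ss0 eqv]]]] := irreducible_classification repr irr nz.
  exists n, a, ss; split => // [j|j k jk].
    have [a0 g0] := ag j; split => //; apply: contraNneq g0 => aj.
      by rewrite /gap aj invr1 subrr.
    by rewrite /gap aj invrN1 subrr.
  split; apply: contraNneq jk => ajk; apply/eqP/pinj; rewrite /point ajk //.
  by rewrite invrK addrC.
- move=> m rho repr irr nz herm.
  have [n [a [ss [n0 ag pinj ss0 eqv]]]] := irreducible_classification repr irr nz.
  have a0 j := (ag j).1; have g0 j := (ag j).2.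
  have ahat1 := rhoAS_hermitian_points a0 g0 pinj ss0 (hermitian_transport eqv herm).
  exists n, a, ss; split => // [j k]; apply: contraNneq => ajk.
  by apply/eqP/pinj; rewrite !pointE ajk.
- move=> n a ss n0 au anq ss0.
  have pinj := ahat_point_inj anq.
  split; first exact: rhoAS_rep.
  + exact: (rhoAS_irreducible (unit_neq0 au) (unit_gap au) pinj ss0).
  + exact: (rhoAS_nonzero (unit_neq0 au)).
  + exact: (rhoAS_hermitian ss (unit_neq0 au) (unit_conj au)).
move=> n a ss n' a' ss' n0 au anq ss0 n'0 a'u a'nq ss'0.
have [a0 g0 pinj] := And3 (unit_neq0 au) (unit_gap au) (ahat_point_inj anq).
have [a'0 g'0 pinj'] := And3 (unit_neq0 a'u) (unit_gap a'u) (ahat_point_inj a'nq).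
have n2 : 2 != 0 :> R[i] by rewrite pnatr_eq0.
split=> [eqv|[_ [sigma [bij sigmaE]]]].
  have eqw := rep_equiv_weights a0 g0 pinj ss0 a'0 eqv.
  (* Matching in both directions gives injections both ways, so the two families have equal size and
     [sigma] is a bijection. *)
  have [sigma sigmaE] := choice (equal_weights_match pinj pinj' ss'0 eqw).
  have [tau tauE] := choice (equal_weights_match pinj' pinj ss0 (fun p => esym (eqw p))).
  have sinj : injective sigma.
    by move=> i j ij; apply: pinj'; rewrite !(sigmaE _).1 ij.
  have tinj : injective tau.
    by move=> i j ij; apply: pinj; rewrite !(tauE _).1 ij.
  have nn' : n = n'.
    have := leq_card tau tinj; have := leq_card sigma sinj; rewrite !card_ord.
    by move=> le1 le2; apply/eqP; rewrite eqn_leq le1 le2.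
  split => //; exists sigma; split.
    by apply: inj_card_bij => //; rewrite !card_ord nn'.
  move=> j; have [pj sj] := sigmaE j; split => //.
  by apply: (mulfI n2); rewrite -!pointE.
(* Both highest weights agree after reindexing by [sigma], and they determine the
   representations. *)
apply: (rhoAS_rep_equiv (repr := rhoAS_rep a ss) a'0 g'0 pinj' ss'0).
  exact: (rhoAS_irreducible a0 g0 pinj ss0).
have [v0 Ev Hv] := rhoAS_highest_weight ss a0; split; [exact: v0|exact: Ev|].
move=> p; rewrite Hv; congr (_ *: _); rewrite /rhoAS_weight (reindex sigma) /=; last first.
  exact: onW_bij.
apply: eq_bigr => j _; have [ej ->] := sigmaE j.
by rewrite !pointE ej.
Qed.
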